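(* Let $(M,D)$ be an affine manifold of dimension $n$, let $N=T^*M$ with projection $\sigma:N\to M$, and let $g_N$ be the modified Riemannian extension metric on $N$. (1) If $(M,D)$ is affine Osserman at $P\in M$, then $(N,g_N)$ is Osserman at every $Q\in\sigma^{-1}(P)$. Moreover, for $\xi\in S^{\pm}(T_QN,g_N)$ the eigenvalues of ${}^{g_N}\mathcal{J}(\xi)$ are $\pm(0,1,\tfrac14)$ with multiplicities $(1,1,2n-2)$, respectively (that is, $0,1,\frac14$ on $S^+(T_QN,g_N)$ and $0,-1,-\frac14$ on $S^-(T_QN,g_N)$). (2) If $(M,D)$ is affine Osserman, then $(N,g_N)$ is Osserman.
   Context: An affine manifold $(M,D)$ is a smooth $n$-dimensional manifold $M$ with a torsion-free connection $D$ on $TM$. Curvature: ${}^DR(X,Y)=D_XD_Y-D_YD_X-D_{[X,Y]}$. Jacobi operator: ${}^D\mathcal{J}(X):Y\mapsto {}^DR(Y,X)X$. $(M,D)$ is affine Osserman at $P$ if ${}^D\mathcal{J}(X)$ is nilpotent for every $X\in T_PM$, and affine Osserman if this holds at every $P\in M$. For a pseudo-Riemannian manifold $(A,g)$, the curvature ${}^gR$ of the Levi-Civita connection has the same sign convention and ${}^g\mathcal{J}(X):Y\mapsto {}^gR(Y,X)X$. $S^{\pm}(T_QA,g)=\{\xi\in T_QA: g(\xi,\xi)=\pm1\}$. $(A,g)$ is Osserman at $Q$ if the eigenvalues of ${}^g\mathcal{J}(\cdot)$ (complex eigenvalues counted with algebraic multiplicity) are constant on $S^+(T_QA,g)$ and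 constant on $S^-(T_QA,g)$; it is Osserman if the eigenvalues are constant on the bundles $S^+(TA,g)$ and $S^-(TA,g)$. Modified Riemannian extension: let $N=T^*M$. Local coordinates $(x_1,\dots,x_n)$ on $M$ induce coordinates $(x_1,\dots,x_n,x_{1'},\dots,x_{n'})$ on $N$ by writing a 1-form as $\omega=x_{i'}dx^i$ (Einstein summation). Write $D_{\partial_{x_i}}\partial_{x_j}={}^D\Gamma_{ij}{}^k\partial_{x_k}$ and $u\circ v=\frac12(u\otimes v+v\otimes u)$. Then $g_N$ is the (globally well-defined) metric of neutral signature $(n,n)$ on $N$ given locally by $g_N=2\,dx^i\circ dx^{i'}+\{x_{i'}x_{j'}-2x_{k'}{}^D\Gamma_{ij}{}^k\}dx^i\circ dx^j$. *)

(* Defs.v *)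
From HB Require Import structures.
From mathcomp Require Import all_boot all_order all_algebra.
From mathcomp Require Import all_classical all_reals all_analysis.
From mathcomp Require Import complex ring lra.

Set Implicit Arguments.
Unset Strict Implicit.
Unset Printing Implicit Defensive.

Import Order.TTheory GRing.Theory Num.Theory.
Import numFieldNormedType.Exports.

Local Open Scope classical_set_scope.
Local Open Scope ring_scope.

(** * Smooth functions on open subsets of R^n *)

Definition pd (R : realType) (n : nat) (V : normedModType R) (i : 'I_n)
  (f : 'rV[R]_n -> V) : 'rV[R]_n -> V := fun x => 'D_(delta_mx 0 i) f x.

(* C^oo: the iterated partial derivatives of all orders exist and are
   differentiable (hence continuous) at every point of U. *)
Definition smooth_on (R : realType) (n : nat) (V : normedModType R)
  (U : set 'rV[R]_n) (f : 'rV[R]_n -> V) : Prop :=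
  forall (s : seq 'I_n) (x : 'rV[R]_n), U x -> differentiable (foldr (@pd R n V) f s) x.

(** * Smooth manifolds *)

(* A set with charts to R^n.  As usual when a manifold is given by an atlas on a
   set, the topology is the one induced by the charts (see [mopen]).  [chart_coord c]
   is meaningful on [chart_dom c] only. *)
Record charted (R : realType) (n : nat) := Charted {
  mpoint : Type;
  chart : Type;
  chart_dom : chart -> set mpoint;
  chart_coord : chart -> mpoint -> 'rV[R]_n
}.

Definition chart_range (R : realType) (n : nat) (M : charted R n) (c : chart M) :
  set 'rV[R]_n := chart_coord c @` chart_dom c.

Definition overlap (R : realType) (n : nat) (M : charted R n) (c c' : chart M) :
  set 'rV[R]_n := chart_coord c @` (chart_dom c `&` chart_dom c').

(* The coordinate change chart_coord c' \o (chart_coord c)^-1 on overlap c c' (0 elsewhere). *)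
Definition transition (R : realType) (n : nat) (M : charted R n) (c c' : chart M)
  (x : 'rV[R]_n) : 'rV[R]_n :=
  xget 0 [set y | exists2 P, (chart_dom c `&` chart_dom c') P & chart_coord c P = x /\ chart_coord c' P = y].

Definition mopen (R : realType) (n : nat) (M : charted R n) (U : set (mpoint M)) : Prop :=
  forall c : chart M, open (chart_coord c @` (chart_dom c `&` U)).

Record smooth_manifold (R : realType) (n : nat) (M : charted R n) : Prop := {
  chart_cover : forall P : mpoint M, exists c : chart M, chart_dom c P;
  chart_inj : forall (c : chart M) (P Q : mpoint M),
    chart_dom c P -> chart_dom c Q -> chart_coord c P = chart_coord c Q -> P = Q;
  overlap_open : forall c c' : chart M, open (overlap c c');
  transition_smooth : forall c c' : chart M, smooth_on (overlap c c') (transition c c');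
  manifold_hausdorff : forall P Q : mpoint M, P <> Q ->
    exists U V : set (mpoint M), [/\ mopen U, mopen V, U P, V Q & U `&` V = set0];
  manifold_second_countable : exists B : nat -> set (mpoint M),
    (forall k, mopen (B k)) /\
    forall (U : set (mpoint M)) (P : mpoint M), mopen U -> U P ->
      exists k, B k P /\ B k `<=` U
}.

(* A tangent vector at P, given by its components in a chart around P.  Two such
   data denote the same vector iff their components are related by the jacobian
   of the coordinate change; all notions below are invariant under this, so that
   quantifying over [tangent P] amounts to quantifying over T_P M. *)
Record tangent (R : realType) (n : nat) (M : charted R n) (P : mpoint M) := Tangent {
  tchart : chart M;
  tchart_dom : chart_dom tchart P;
  tvec : 'rV[R]_n
}.

(** * Local differential geometry in coordinates *)

Definition vfield (R : realType) (n : nat) := 'rV[R]_n -> 'rV[R]_n.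

(* G i j k x is the coefficient Gamma_ij^k at the point with coordinates x. *)
Definition christoffel (R : realType) (n : nat) := 'I_n -> 'I_n -> 'I_n -> 'rV[R]_n -> R.

(* D_X Y, where D_(d_i) d_j = Gamma_ij^k d_k *)
Definition cov (R : realType) (n : nat) (G : christoffel R n) (X Y : vfield R n) :
  vfield R n := fun x => \row_k
    (\sum_i X x 0 i * pd i (fun y => Y y 0 k) x +
     \sum_i \sum_j X x 0 i * Y x 0 j * G i j k x).

Definition bracket (R : realType) (n : nat) (X Y : vfield R n) : vfield R n :=
  fun x => \row_k \sum_i (X x 0 i * pd i (fun y => Y y 0 k) x -
                          Y x 0 i * pd i (fun y => X y 0 k) x).

Definition curvature (R : realType) (n : nat) (G : christoffel R n)
  (X Y Z : vfield R n) : vfield R n :=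
  fun x => cov G X (cov G Y Z) x - cov G Y (cov G X Z) x - cov G (bracket X Y) Z x.

(* The matrix, acting on row vectors, of Y |-> R(Y,X)X on the tangent space at the
   point with coordinates x.  The curvature being tensorial, it is evaluated on the
   vector fields with constant components. *)
Definition jacobi (R : realType) (n : nat) (G : christoffel R n) (x X : 'rV[R]_n) :
  'M[R]_n := lin1_mx (fun Y : 'rV[R]_n => curvature G (cst Y) (cst X) (cst X) x).

(** * Affine manifolds *)

Definition connection (R : realType) (n : nat) (M : charted R n) :=
  chart M -> christoffel R n.

(* The second clause is the transformation law expressing that the local
   covariant derivatives agree on overlaps: with y the coordinate change,
   D_(d_i) d_j = D_(d_i) (sum_b (d_j y^b) d'_b). *)
Definition is_connection (R : realType) (n : nat) (M : charted R n)
  (D : connection M) : Prop :=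
  (forall (c : chart M) (i j k : 'I_n), smooth_on (chart_range c) (D c i j k)) /\
  forall (c c' : chart M) (x : 'rV[R]_n), overlap c c' x ->
    let y := transition c c' in
    forall i j l : 'I_n,
      \sum_k D c i j k x * jacobian y x k l =
      pd i (fun z => jacobian y z j l) x +
      \sum_a \sum_b jacobian y x i a * jacobian y x j b * D c' a b l (y x).

Definition torsion_free (R : realType) (n : nat) (M : charted R n)
  (D : connection M) : Prop :=
  forall (c : chart M) (X Y : vfield R n),
    smooth_on (chart_range c) X -> smooth_on (chart_range c) Y ->
    forall x, chart_range c x -> cov (D c) X Y x - cov (D c) Y X x = bracket X Y x.

Record affine_manifold (R : realType) (n : nat) := AffineManifold {
  am_space :> charted R n;
  am_smooth : smooth_manifold am_space;
  am_conn : connection am_space;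
  am_connection : is_connection am_conn;
  am_torsion_free : torsion_free am_conn
}.

Arguments am_conn {R n} M : rename.

Definition affine_osserman_at (R : realType) (n : nat) (M : affine_manifold R n)
  (P : mpoint M) : Prop :=
  forall X : tangent P, exists k : nat,
    jacobi (am_conn M (tchart X)) (chart_coord (tchart X) P) (tvec X) ^+ k = 0.

Arguments affine_osserman_at {R n} M P.

Definition affine_osserman (R : realType) (n : nat) (M : affine_manifold R n) : Prop :=
  forall P : mpoint M, affine_osserman_at M P.

(** * Pseudo-Riemannian metrics *)

(* The Gram matrices of a metric in the coordinate frames of the charts. *)
Definition gram (R : realType) (m : nat) (A : charted R m) :=
  chart A -> 'rV[R]_m -> 'M[R]_m.

Definition levi_civita (R : realType) (m : nat) (g : 'rV[R]_m -> 'M[R]_m) :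
  christoffel R m := fun i j k x =>
  2^-1 * \sum_l invmx (g x) k l *
    (pd i (fun y => g y j l) x + pd j (fun y => g y i l) x - pd l (fun y => g y i j) x).

(* At every point, levi_civita g is the only torsion-free connection for which g is
   parallel: d_k g_ij = g(D_k d_i, d_j) + g(d_i, D_k d_j). *)
Lemma levi_civitaP (R : realType) (m : nat) (g : 'rV[R]_m -> 'M[R]_m)
    (G : christoffel R m) (x : 'rV[R]_m) :
  (forall y, (g y)^T = g y) -> g x \in unitmx ->
  (forall i j k, G i j k x = G j i k x) /\
  (forall i j k, pd k (fun y => g y i j) x =
     \sum_l G k i l x * g x l j + \sum_l G k j l x * g x i l) <->
  (forall i j k, G i j k x = levi_civita g i j k x).
Proof.
move=> gT gU.
have gsym y i j : g y i j = g y j i by rewrite -[in LHS](gT y) mxE.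
set d := fun k i j => pd k (fun y => g y i j) x.
have dsym k i j : d k i j = d k j i.
  by rewrite /d; congr (pd k _ x); apply/funext => y; rewrite gsym.
have giC k l : invmx (g x) k l = invmx (g x) l k.
  by rewrite -[in LHS](gT x) -trmx_inv mxE.
have lower (H : christoffel R m) i j l :
    (forall k, H i j k x = levi_civita g i j k x) ->
    \sum_k H i j k x * g x k l = 2^-1 * (d i j l + d j i l - d l i j).
  move=> HE; pose v := \row_l' (2^-1 * (d i j l' + d j i l' - d l' i j)).
  transitivity ((v *m invmx (g x) *m g x) 0 l); last first.
    by rewrite mulmxKV // mxE.
  rewrite mxE; apply: eq_bigr => k _; rewrite HE; congr (_ * _).
  rewrite /levi_civita mxE mulr_sumr; apply: eq_bigr => l' _.
  by rewrite mxE giC /d; ring.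
split=> [[Gsym Gpar] i j k|GE].
  pose w := \row_k' G i j k' x.
  have wE l : (w *m g x) 0 l = 2^-1 * (d i j l + d j i l - d l i j).
    rewrite mxE /d !Gpar.
    have cE a b c : \sum_l' G a b l' x * g x c l' = \sum_l' G a b l' x * g x l' c.
      by apply: eq_bigr => l' _; rewrite gsym.
    have sE a b c : \sum_l' G a b l' x * g x l' c = \sum_l' G b a l' x * g x l' c.
      by apply: eq_bigr => l' _; rewrite Gsym.
    have -> : \sum_l' w 0 l' * g x l' l = \sum_l' G i j l' x * g x l' l.
      by apply: eq_bigr => l' _; rewrite mxE.
    rewrite !cE (sE j i l) (sE l i j) (sE l j i).
    set p := \sum_ _ _; set q := \sum_l' G i l l' x * _.
    set r := \sum_l' G j l l' x * _; lra.
  have -> : G i j k x = (w *m g x *m invmx (g x)) 0 k.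
    by rewrite mulmxK // mxE.
  rewrite /levi_civita mxE mulr_sumr; apply: eq_bigr => l _.
  by rewrite wE giC /d; ring.
split=> [i j k|i j k].
  rewrite !GE /levi_civita; congr (_ * _); apply: eq_bigr => l _.
  by rewrite -!/(d _ _ _) (dsym l i j) (addrC (d i j l)).
have -> : \sum_l G k j l x * g x i l = \sum_l G k j l x * g x l i.
  by apply: eq_bigr => l _; rewrite gsym.
rewrite (lower G k i j) 1?(lower G k j i) -/(d k i j); try by move=> ?; exact: GE.
rewrite (dsym k j i) (dsym j k i) (dsym i k j).
set a := d k i j; set b := d i j k; set c := d j i k; lra.
Qed.

(* S^+ (e = 1) and S^- (e = -1) *)
Definition unit_tangent (R : realType) (m : nat) (A : charted R m) (g : gram A)
  (e : R) (Q : mpoint A) (xi : tangent Q) : Prop :=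
  \sum_i \sum_j g (tchart xi) (chart_coord (tchart xi) Q) i j * tvec xi 0 i * tvec xi 0 j = e.

Definition jacobi_g (R : realType) (m : nat) (A : charted R m) (g : gram A)
  (Q : mpoint A) (xi : tangent Q) : 'M[R]_m :=
  jacobi (levi_civita (g (tchart xi))) (chart_coord (tchart xi) Q) (tvec xi).

(* Algebraic multiplicity of z as a complex eigenvalue of a real matrix (0 if z is
   not an eigenvalue). *)
Definition eigen_mult (R : realType) (m : nat) (A : 'M[R]_m) (z : R[i]) : nat :=
  mup z (char_poly (map_mx (real_complex R) A)).

Definition same_eigenvalues (R : realType) (m : nat) (A B : 'M[R]_m) : Prop :=
  forall z : R[i], eigen_mult A z = eigen_mult B z.

Definition osserman_at (R : realType) (m : nat) (A : charted R m) (g : gram A)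
  (Q : mpoint A) : Prop :=
  forall e : R, e = 1 \/ e = -1 -> forall xi eta : tangent Q,
    unit_tangent g e xi -> unit_tangent g e eta ->
    same_eigenvalues (jacobi_g g xi) (jacobi_g g eta).

Definition osserman (R : realType) (m : nat) (A : charted R m) (g : gram A) : Prop :=
  forall e : R, e = 1 \/ e = -1 ->
  forall (Q Q' : mpoint A) (xi : tangent Q) (eta : tangent Q'),
    unit_tangent g e xi -> unit_tangent g e eta ->
    same_eigenvalues (jacobi_g g xi) (jacobi_g g eta).

(** * The cotangent bundle and the modified Riemannian extension *)

(* A covector at P is the family of its components in the charts around P (with the
   value 0 for the other charts, so that distinct families are distinct covectors),
   transforming by omega_i = omega'_a d_i y^a. *)
Record covector (R : realType) (n : nat) (M : charted R n) (P : mpoint M) := Covector {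
  cvec : chart M -> 'rV[R]_n;
  cvec_out : forall c, ~ chart_dom c P -> cvec c = 0;
  cvec_transition : forall c c', chart_dom c P -> chart_dom c' P ->
    cvec c = cvec c' *m (jacobian (transition c c') (chart_coord c P))^T
}.

Definition cotangent (R : realType) (n : nat) (M : charted R n) : charted R (n + n) :=
  @Charted R (n + n) {P : mpoint M & covector P} (chart M)
    (fun c => [set Q | chart_dom c (projT1 Q)])
    (fun c Q => row_mx (chart_coord c (projT1 Q)) (cvec (projT2 Q) c)).

Definition cot_proj (R : realType) (n : nat) (M : charted R n)
  (Q : mpoint (cotangent M)) : mpoint M := projT1 Q.

(* 2 dx^i o dx^i' + (p_i p_j - 2 p_k Gamma_ij^k) dx^i o dx^j, where p_i = x_i' and
   u o v is the symmetrized tensor product. *)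
Definition modified_extension (R : realType) (n : nat) (M : affine_manifold R n) :
  gram (cotangent M) := fun (c : chart M) z =>
  let x := lsubmx z in let p := rsubmx z in
  block_mx
    (\matrix_(i, j) (p 0 i * p 0 j - 2 * \sum_k p 0 k * am_conn M c i j k x)) 1%:M
    1%:M 0.

Arguments modified_extension {R n} M.

(* Main.v *)
Require Import Defs.
From HB Require Import structures.
From mathcomp Require Import all_boot all_order all_algebra.
From mathcomp Require Import all_classical all_reals all_analysis.
From mathcomp Require Import complex ring.
Import Order.TTheory GRing.Theory Num.Theory.
Import numFieldNormedType.Exports.
Local Open Scope classical_set_scope.
Local Open Scope ring_scope.

Set Implicit Arguments.
Unset Strict Implicit.

(** At a point z = (x, p) of T*M and for a tangent vector Z = (X, w), write
    A for the quadratic part of the metric, a = X A and e = g(Z, Z) = (a + 2w)(X).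
    The horizontal part of the Levi-Civita connection of g_N is the projectively
    changed connection Gamma_ij^k - (p_i delta_j^k + p_j delta_i^k) / 2, and the
    vertical distribution is parallel.  Hence, with E the Jacobi operator of D in
    the direction X, the Jacobi operator of Z is (acting on row vectors)
      J = [ E + e/4 + (w/2 - a/4)^T X     S                          ]
          [ - X^T X                       E^T + e/4 + X^T (w/2 + 3a/4) ].
    The block S, which contains second derivatives of the Christoffel symbols of
    D, is never computed: Z J = 0 is all that is needed about it.  Indeed
      J = e/4 + N - phi^T Z / 4 + 3 psi^T W / 4,   N = [E, B; 0, E^T],
    with phi = (a + w, X), psi = (w, - X), W = (X, - w - a) (phi is the metric
    dual of Z, and W is the para-complex image of Z).  N is nilpotent with Z N = 0,
    and the resolvent of N satisfies W (s - N)^-1 psi^T = e/s, so that the matrix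
    determinant lemma gives the characteristic polynomial t (t - e) (t - e/4)^(2n-2). *)

(** * Nilpotent perturbations of rank two *)

(** Over polynomials, ['X - E] divides ['X^k - E ^+ k], which is the scalar matrix ['X^k]. Taking
    determinants, the characteristic polynomial divides a power of ['X]; being monic of degree [n],
    it is ['X^n]. *)
Lemma char_poly_nilpotent (F : fieldType) (n k : nat) (E : 'M[F]_n) :
  E ^+ k = 0 -> char_poly E = 'X^n.
Proof.
move=> Ek0.
have dvd : char_poly E %| 'X^(k * n).
  have comm : GRing.comm ('X%:M : 'M[{poly F}]_n) (map_mx polyC E).
    by rewrite /GRing.comm; apply/esym/scalar_mxC.
  have mapX j : map_mx polyC E ^+ j = map_mx polyC (E ^+ j).
    by elim: j => [|j IH]; rewrite ?expr0 ?map_mx1 // !exprS IH [RHS]map_mxM.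
  have scalX j : ('X%:M : 'M[{poly F}]_n) ^+ j = ('X^j)%:M.
    by elim: j => [|j IH]; rewrite ?expr0 // !exprS IH [RHS]scalar_mxM.
  have := subrXX_comm k comm; rewrite mapX Ek0 map_mx0 subr0 scalX.
  move=> /(congr1 determinant).
  by rewrite det_scalar det_mulmx -exprM => ->; apply: dvdp_mulr.
have /dvdp_exp_XsubCP[m [_]] : char_poly E %| ('X - 0%:P) ^+ (k * n) by rewrite subr0.
rewrite subr0 => eqm.
have := eqp_size eqm; rewrite size_char_poly size_polyXn => -[nm].
suff : char_poly E = 'X^m by rewrite -nm.
by apply/eqP; rewrite -eqp_monic ?char_poly_monic ?monicXn.
Qed.

Lemma horner_char_poly (F : fieldType) (n : nat) (A : 'M[F]_n) (t : F) :
  (char_poly A).[t] = \det (t%:M - A).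
Proof.
rewrite -[LHS]/(horner_eval t _) -det_map_mx; congr determinant.
by apply/matrixP=> i j; rewrite !mxE /= /horner_eval hornerD hornerN hornerMn hornerX hornerC.
Qed.

(** Matrix determinant lemma, proved by reducing the block matrix [B] to triangular form in two
    ways. Writing the row factor as [y *m A] keeps the formula free of the inverse of [A], so that
    it applies to a possibly singular [A]. *)
Lemma det_sub_rank1 (F : fieldType) (m : nat) (A : 'M[F]_m) (c : 'cV_m) (y : 'rV_m) :
  \det (A - c *m (y *m A)) = (1 - (y *m c) 0 0) * \det A.
Proof.
have -> : A - c *m (y *m A) = (1%:M - c *m y) *m A by rewrite mulmxBl mul1mx mulmxA.
rewrite det_mulmx; congr (_ * _).
pose B := block_mx 1%:M c y (1%:M : 'M[F]_1).
have /(congr1 determinant) : B *m block_mx 1%:M 0 (- y) 1%:M =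
    block_mx (1%:M - c *m y) c 0 1%:M.
  by rewrite mulmx_block !mul1mx !mulmx1 !mulmx0 !add0r mulmxN subrr.
have /(congr1 determinant) : block_mx 1%:M 0 (- y) 1%:M *m B =
    block_mx 1%:M c 0 (1%:M - y *m c).
  by rewrite mulmx_block !mul1mx !mulmx1 !mul0mx !addr0 mulNmx addNr [- _ + _]addrC.
rewrite !det_mulmx !det_lblock !det_ublock !det1 !mul1r !mulr1.
by move=> -> <-; rewrite det_mx11 !mxE.
Qed.

Lemma horner_inj (F : numDomainType) (p q : {poly F}) :
  (forall t, p.[t] = q.[t]) -> p = q.
Proof.
move=> pq; apply/eqP; rewrite -subr_eq0; apply/eqP/(@roots_geq_poly_eq0 _ _ [seq i%:R | i <- iota 0 (size (p - q))]).
- by apply/allP => x _; rewrite rootE hornerD hornerN pq subrr.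
- by rewrite map_inj_uniq ?iota_uniq // => i j /eqP; rewrite eqr_nat => /eqP.
- by rewrite size_map size_iota.
Qed.

Lemma dotmxC (F : comNzRingType) (n : nat) (u v : 'rV[F]_n) : u *m v^T = v *m u^T.
Proof. by rewrite -[RHS]trmxK trmx_mul trmxK; apply/matrixP=> i j; rewrite !ord1 [RHS]mxE. Qed.

(* Both rank one terms are removed by [det_sub_rank1]: the row Z satisfies
   Z (s - N - K) = s Z, and y = W (s - N)^-1 satisfies y psi^T = e / s. *)
Lemma det_sub_nilpotent_rank2 (F : realFieldType) (n k : nat) (X w a : 'rV[F]_n) (E B : 'M[F]_n)
    (e s : F) :
  (a + 2 *: w) *m X^T = e%:M -> E ^+ k = 0 -> X *m E = 0 ->
  X *m B + w *m E^T = 0 -> s != 0 ->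
  \det (s%:M - (block_mx E B 0 E^T - 4^-1 *: ((row_mx (a + w) X)^T *m row_mx X w)
                + (3 / 4) *: ((row_mx w (- X))^T *m row_mx X (- w - a)))) * s ^+ 2
  = (s + e / 4) * (s - 3 * e / 4) * s ^+ (n + n).
Proof.
move=> aX Ek0 XE XB s0.
set N := block_mx _ _ _ _; set Z := row_mx X w; set W := row_mx X _.
set phi := row_mx (a + w) X; set psi := row_mx w (- X).
have E2 : (w *m X^T) + (a + w) *m X^T = e%:M.
  by rewrite -aX -mulmxDl addrCA -mulr2n scaler_nat.
have Zphi : Z *m phi^T = e%:M.
  by rewrite /Z /phi tr_row_mx mul_row_col addrC (dotmxC X) E2.
have Zpsi : Z *m psi^T = 0.
  by rewrite /Z /psi tr_row_mx mul_row_col linearN mulmxN dotmxC subrr.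
have ZN : Z *m N = 0.
  by rewrite /Z /N mul_row_block XE XB mulmx0 addr0 row_mx0.
have detN : \det (s%:M - N) = s ^+ (n + n).
  have detE : \det (s%:M - E) = s ^+ n.
    by rewrite -horner_char_poly (char_poly_nilpotent Ek0) hornerXn.
  rewrite scalar_mx_block /N opp_block_mx add_block_mx oppr0 addr0 det_ublock detE.
  by rewrite -[s%:M]tr_scalar_mx -linearB /= det_tr detE exprD.
have unitN : s%:M - N \in unitmx by rewrite unitmxE detN unitfE expf_neq0.
set A2 := s%:M - N - (3 / 4) *: (psi^T *m W).
have ZA2 : Z *m A2 = s *: Z.
  by rewrite !mulmxBr ZN subr0 -scalemxAr mulmxA Zpsi mul0mx scaler0 subr0 mul_mx_scalar.
(* [Z] is a left eigenvector of [A2] for the eigenvalue [s], so [Z] is [s^-1 *: (Z *m A2)] and the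
   [phi] term takes the shape required by [det_sub_rank1]. *)
have -> : s%:M - (N - 4^-1 *: (phi^T *m Z) + (3 / 4) *: (psi^T *m W)) =
    A2 - phi^T *m ((- (4^-1 * s^-1) *: Z) *m A2).
  rewrite -scalemxAl ZA2 scalerA mulNr mulfVK // -scalemxAr scaleNr opprK /A2.
  by rewrite !opprD opprK !addrA -!addrA [X in _ + (_ + X)]addrC.
rewrite det_sub_rank1 -scalemxAl Zphi.
pose y := W *m invmx (s%:M - N).
have yN : y *m (s%:M - N) = W by rewrite mulmxKV.
have ypsi : y *m psi^T = (e / s)%:M.
  (* Solve [y *m (s%:M - N) = W] by blocks. Since [X *m E = 0], the first block is [s^-1 *: X]. The
     second is only needed against [X^T], where both [E^T *m X^T] and [X *m B *m X^T] vanish, so the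
     unknown [B] drops out. *)
  pose y1 := lsubmx y; pose y2 := rsubmx y.
  have yE : y = row_mx y1 y2 by rewrite hsubmxK.
  move: yN; rewrite scalar_mx_block /N opp_block_mx add_block_mx oppr0 addr0 yE.
  rewrite mul_row_block mulmx0 addr0 => /eq_row_mx[y1E y2E].
  have y1X : y1 = s^-1 *: X.
    have unitE : s%:M - E \in unitmx.
      by rewrite unitmxE -horner_char_poly (char_poly_nilpotent Ek0) hornerXn unitfE expf_neq0.
    apply: (can_inj (mulmxK unitE)); rewrite y1E -scalemxAl mulmxBr XE subr0.
    by rewrite mul_mx_scalar scalerA mulVf // scale1r.
  have y2X : y2 *m X^T = - s^-1 *: ((w + a) *m X^T).
    have EX : E^T *m X^T = 0 by rewrite -trmx_mul XE trmx0.
    have XBX : X *m B *m X^T = 0.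
      by rewrite (eqP (_ : X *m B == - (w *m E^T))) ?mulNmx -?mulmxA ?EX ?mulmx0 ?oppr0 // -addr_eq0 XB.
    move/(congr1 (mulmx^~ X^T)): y2E; rewrite add0r y1X.
    rewrite mulmxDl mulmxN -scalemxAl mulNmx -scalemxAl XBX scaler0 oppr0 add0r.
    rewrite mulmxBr mul_mx_scalar mulmxBl -(mulmxA y2) EX mulmx0 subr0 -scalemxAl.
    rewrite -opprD mulNmx => /(congr1 ( *:%R s^-1)); rewrite scalerA mulVf // scale1r => ->.
    by rewrite scalerN scaleNr.
  rewrite /psi tr_row_mx mul_row_col linearN mulmxN y2X y1X -scalemxAl scaleNr opprK -scalerDr.
  by rewrite (dotmxC X) (addrC w) E2 scale_scalar_mx mulrC.
have -> : A2 = (s%:M - N) - ((3 / 4) *: psi^T) *m (y *m (s%:M - N)).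
  by rewrite yN -scalemxAl.
rewrite det_sub_rank1 detN -scalemxAr ypsi !mxE eqxx !mulr1n.
by field.
Qed.

(** Apart from the shift by [e / 4], [J] is the matrix of [det_sub_nilpotent_rank2]. With
    [s = t - e / 4] the two exceptional factors [s + e / 4] and [s - 3 * e / 4] become [t] and
    [t - e]. *)
Lemma char_poly_osserman (F : realFieldType) (n k : nat) (X w a : 'rV[F]_n)
    (E S : 'M[F]_n) (e : F) :
  let J := block_mx (E + (e / 4)%:M + (2^-1 *: w - 4^-1 *: a)^T *m X) S
    (- (X^T *m X)) (E^T + (e / 4)%:M + X^T *m (2^-1 *: w + (3 / 4) *: a)) in
  (0 < n)%N -> (a + 2 *: w) *m X^T = e%:M -> E ^+ k = 0 -> X *m E = 0 ->
  row_mx X w *m J = 0 ->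
  char_poly J = 'X * ('X - e%:P) * ('X - (e / 4)%:P) ^+ (2 * n - 2).
Proof.
move=> J n0 aX Ek0 XE ZJ.
(* [B] is what remains of [S] once the upper right blocks of the two rank one terms are taken
   away. *)
pose B := S + 4^-1 *: ((a + w)^T *m w) - (3 / 4) *: (w^T *m (- w - a)).
pose K := block_mx E B 0 E^T - 4^-1 *: ((row_mx (a + w) X)^T *m row_mx X w)
                + (3 / 4) *: ((row_mx w (- X))^T *m row_mx X (- w - a)).
have JK : J = (e / 4)%:M + K.
  rewrite /J /K scalar_mx_block !tr_row_mx !mul_col_row.
  rewrite !scale_block_mx opp_block_mx !add_block_mx; congr block_mx.
  - by apply/matrixP => i j; rewrite !mxE !big_ord1 !mxE; field.
  - by apply/matrixP => i j; rewrite !mxE !big_ord1 !mxE; field.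
  - by apply/matrixP => i j; rewrite !mxE !big_ord1 !mxE; field.
  - by apply/matrixP => i j; rewrite !mxE !big_ord1 !mxE; field.
(* This is the right half of [row_mx X w *m J = 0], the only information available on [S]. *)
have XB : X *m B + w *m E^T = 0.
  have E2 : w *m X^T + (a + w) *m X^T = e%:M.
    by rewrite -aX -mulmxDl addrCA -mulr2n scaler_nat.
  move: ZJ; rewrite mul_row_block -row_mx0 => /eq_row_mx[_ <-].
  rewrite /B !mulmxDr -!addrA; congr (_ + _); rewrite mul_mx_scalar mulmxN -!scalemxAr.
  rewrite !mulmxDr !mulmxN !mulmxA (dotmxC X) (dotmxC X w).
  have wX : w *m X^T = e%:M - (a + w) *m X^T by rewrite -E2 addrK.
  rewrite wX; move: (_ *m X^T) => c; apply/matrixP => i j.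
  by rewrite !mxE !big_ord1 !mxE !ord1 eqxx mulr1n; field.
(* The determinant formula carries a factor [s ^+ 2] and excludes [s = 0]. After multiplication by
   the matching square, both sides vanish at [t = e / 4], because [0 < n], and the exponent
   [2 * n - 2 + 2] is really [2 * n]. *)
apply: (@mulIf _ (('X - (e / 4)%:P) ^+ 2)); first by rewrite expf_neq0 // polyXsubC_eq0.
rewrite -[RHS]mulrA -exprD subnK; last by rewrite mul2n -addnn (@leq_add 1 1).
apply: horner_inj => t; rewrite !(hornerM, horner_exp, hornerXsubC, hornerX) horner_char_poly.
have [t0|t0] := eqVneq (t - e / 4) 0.
  by rewrite t0 !expr0n muln_eq0 /= -[n == 0%N]negbK -lt0n n0 !mulr0.
rewrite JK; have -> : t%:M - ((e / 4)%:M + K) = (t - e / 4)%:M - K.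
  by rewrite raddfB opprD addrA.
rewrite (det_sub_nilpotent_rank2 aX Ek0 XE XB t0) mul2n -addnn; congr (_ * _).
by field.
Qed.

(** Multiplicities add over products; the sum of indicators remains correct when some of [0], [a]
    and [b] coincide. *)
Lemma eigen_mult_char_poly (R : realType) (m k : nat) (J : 'M[R]_m) (a b : R) (z : R[i]) :
  char_poly J = 'X * ('X - a%:P) * ('X - b%:P) ^+ k ->
  eigen_mult J z = ((z == 0)%R + (z == a%:C%C)%R + k * (z == b%:C%C)%R)%N.
Proof.
move=> JE; rewrite /eigen_mult -map_char_poly JE.
rewrite !rmorphM rmorphXn !rmorphB /= !map_polyX !map_polyC /=.
have mupE j (c : R[i]) : mup z (('X - c%:P) ^+ j) = (j * (z == c))%N.
  by rewrite mup_XsubCX eq_sym; case: eqP => _; rewrite ?muln1 ?muln0.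
have mupX : mup z ('X : {poly R[i]}) = (z == 0).
  by rewrite -['X]subr0 -polyC0 -[_ - _]expr1 mupE mul1n.
have nz j (c : R[i]) : ('X - c%:P) ^+ j != 0 by rewrite expf_neq0 // polyXsubC_eq0.
have nz1 (c : R[i]) : 'X - c%:P != 0 by rewrite polyXsubC_eq0.
rewrite mupM ?mulf_neq0 ?polyX_eq0 // mupM ?polyX_eq0 // mupX mupE.
by rewrite -[X in mup z X]expr1 mupE mul1n.
Qed.

(** * The Jacobi operator in matrix form *)

Section PointwiseDerive.
Variables (R : realType) (V : normedModType R).
Implicit Types (f g : V -> R) (x v : V).

Lemma is_derive_mul f g x v (df dg : R) :
  is_derive x v f df -> is_derive x v g dg ->
  is_derive x v (fun y => f y * g y) (f x * dg + df * g x).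
Proof.
move=> hf hg; apply: is_derive_eq (is_deriveM hf hg) _.
by rewrite /GRing.scale /= (mulrC (g x)).
Qed.

Lemma is_derive_add f g x v (df dg : R) :
  is_derive x v f df -> is_derive x v g dg ->
  is_derive x v (fun y => f y + g y) (df + dg).
Proof. by move=> hf hg; exact: is_deriveD. Qed.

Lemma is_derive_opp f x v (df : R) :
  is_derive x v f df -> is_derive x v (fun y => - f y) (- df).
Proof. by move=> hf; exact: is_deriveN. Qed.

Lemma is_derive_scale f x v (c df : R) :
  is_derive x v f df -> is_derive x v (fun y => c * f y) (c * df).
Proof. by move=> hf; exact: is_deriveZ. Qed.

Lemma is_derive_scaler f x v (c df : R) :
  is_derive x v f df -> is_derive x v (fun y => f y * c) (df * c).
Proof.
move=> hf; rewrite (_ : (fun y => f y * c) = fun y => c * f y) 1?mulrC.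
  exact: is_derive_scale.
by apply/funext => y; rewrite mulrC.
Qed.

Lemma is_derive_bigsum (n : nat) (h : 'I_n -> V -> R) x v (dh : 'I_n -> R) :
  (forall i, is_derive x v (h i) (dh i)) ->
  is_derive x v (fun y => \sum_i h i y) (\sum_i dh i).
Proof.
move=> hh; rewrite (_ : (fun y => _) = \sum_i h i); first exact: is_derive_sum.
by apply/funext => y; rewrite fct_sumE.
Qed.

End PointwiseDerive.

Lemma is_derive_coord (R : realType) (n : nat) (x v : 'rV[R]_n) (j : 'I_n) :
  is_derive x v (fun y : 'rV[R]_n => y 0 j) (v 0 j).
Proof.
have did : derivable (id : 'rV[R]_n -> 'rV[R]_n) x v by exact: derivable_id.
apply: DeriveDef; first exact: (derivable_mxP _ _ _).1 did 0 j.
have := derive_mx did; rewrite derive_id => /matrixP/(_ 0 j).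
by rewrite mxE => ->.
Qed.

Lemma is_derive_rsubmx (R : realType) (n1 n2 : nat) (z v : 'rV[R]_(n1 + n2)) (j : 'I_n2) :
  is_derive z v (fun y => rsubmx y 0 j) (rsubmx v 0 j).
Proof.
rewrite mxE (_ : (fun y => _) = fun y : 'rV[R]_(n1 + n2) => y 0 (rshift n1 j)).
  exact: is_derive_coord.
by apply/funext => y; rewrite mxE.
Qed.

(** As [lsubmx] is linear, the two difference quotients are the same function of [h]; directional
    derivability of [f] therefore suffices. *)
Lemma is_derive_lsubmx (R : realType) (n1 n2 : nat) (f : 'rV[R]_n1 -> R)
    (z v : 'rV[R]_(n1 + n2)) (d : R) :
  is_derive (lsubmx z) (lsubmx v) f d -> is_derive z v (fun y => f (lsubmx y)) d.
Proof.
have E : (fun h : R => h^-1 *: (((fun y => f (lsubmx y)) \o shift z) (h *: v) - f (lsubmx z)))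
   = (fun h : R => h^-1 *: ((f \o shift (lsubmx z)) (h *: lsubmx v) - f (lsubmx z))).
  apply/funext => h /=; congr (_ *: (f _ - _)).
  by apply/rowP => j; rewrite !mxE.
by case=> [df <-]; apply: DeriveDef; rewrite /derivable /derive E.
Qed.

(** * Curvature evaluated on constant vector fields *)

Section Jacobi.
Variables (R : realType) (n : nat).
Implicit Types (G : christoffel R n) (x X Y Z : 'rV[R]_n).

(* The matrix of Y |-> D_Y Z for Y and Z with constant components. *)
Definition conn_mx G Z x : 'M[R]_n := \matrix_(a, k) \sum_c Z 0 c * G a c k x.

Lemma conn_mxB G (a b : R) Z Y x :
  conn_mx G (a *: Z - b *: Y) x = a *: conn_mx G Z x - b *: conn_mx G Y x.
Proof.
apply/matrixP=> i k; rewrite !mxE !mulr_sumr -sumrB; apply: eq_bigr => c _.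
by rewrite !mxE; ring.
Qed.

Lemma mul_conn_mx G Z Y x k :
  (Y *m conn_mx G Z x) 0 k = \sum_i \sum_j Y 0 i * Z 0 j * G i j k x.
Proof.
rewrite mxE; apply: eq_bigr => i _; rewrite mxE mulr_sumr.
by apply: eq_bigr => j _; rewrite mulrA.
Qed.

Lemma mul_conn_mxC G Z Y x : (forall a b k, G a b k x = G b a k x) ->
  Y *m conn_mx G Z x = Z *m conn_mx G Y x.
Proof.
move=> Gsym; apply/rowP=> k; rewrite !mul_conn_mx exchange_big.
by apply: eq_bigr => i _; apply: eq_bigr => j _; rewrite Gsym; ring.
Qed.

Lemma pd_cst (W : normedModType R) (i : 'I_n) (c : W) x : pd i (fun _ => c) x = 0.
Proof. exact: derive_cst. Qed.

Lemma cov_cst G X Y x : cov G (cst X) (cst Y) x = X *m conn_mx G Y x.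
Proof.
apply/rowP=> k; rewrite mul_conn_mx mxE big1 ?add0r // => i _.
by rewrite /= pd_cst mulr0.
Qed.

(** For constant fields the bracket vanishes, and row [a] is D_Y D_Z Z - D_Z D_Y Z with Y the
    coordinate field of index [a]. Each iterated derivative splits into a term differentiating the
    coefficients and a quadratic one; symmetry of [G] turns the last quadratic term into a matrix
    square. *)
Lemma jacobi_conn_mx G x Z : (forall a b k, G a b k x = G b a k x) ->
  jacobi G x Z =
    \matrix_(a, k) pd a (fun y => (Z *m conn_mx G Z y) 0 k) x
  - \matrix_(a, k) \sum_b Z 0 b * pd b (fun y => conn_mx G Z y a k) x
  + conn_mx G (Z *m conn_mx G Z x) x - conn_mx G Z x *m conn_mx G Z x.
Proof.
move=> Gsym; apply/matrixP => a k; rewrite [LHS]mxE /curvature.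
have covc X Y : cov G (cst X) (cst Y) = fun y => X *m conn_mx G Y y.
  by apply/funext => y; exact: cov_cst.
have -> : cov G (bracket (cst (delta_mx 0 a)) (cst Z)) (cst Z) x = 0.
  have b0 i : bracket (cst (delta_mx 0 a)) (cst Z) x 0 i = 0.
    by rewrite mxE big1 // => j _; rewrite /= !pd_cst !mulr0 subrr.
  apply/rowP => j; rewrite !mxE !big1 ?addr0 // => i _; last by rewrite b0 mul0r.
  by rewrite big1 // => l _; rewrite b0 !mul0r.
have covE X (W : 'rV[R]_n -> 'rV[R]_n) : cov G (cst X) W x =
    \row_j (\sum_i X 0 i * pd i (fun y => W y 0 j) x) + X *m conn_mx G (W x) x.
  by apply/rowP=> j; rewrite [RHS]mxE mul_conn_mx !mxE.
rewrite subr0 !covc !covE.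
have sumd (f : 'I_n -> R) : \sum_i (delta_mx 0 a : 'rV[R]_n) 0 i * f i = f a.
  rewrite (bigD1 a) //= mxE !eqxx mul1r big1 ?addr0 // => i ia.
  by rewrite mxE eqxx (negPf ia) mul0r.
have deltaE (M : 'M[R]_n) : delta_mx 0 a *m M = row a M by rewrite -rowE.
have pdE i : pd i (fun y => ((delta_mx 0 a : 'rV[R]_n) *m conn_mx G Z y) 0 k) x =
    pd i (fun y => conn_mx G Z y a k) x.
  by congr (pd _ _ x); apply/funext => y; rewrite deltaE mxE.
have connE : (Z *m conn_mx G ((delta_mx 0 a : 'rV[R]_n) *m conn_mx G Z x) x) 0 k =
    (conn_mx G Z x *m conn_mx G Z x) a k.
  by rewrite (@mul_conn_mxC G _ Z) // deltaE -row_mul mxE.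
have mxD p q (A B : 'M[R]_(p, q)) i j : (A + B) i j = A i j + B i j by rewrite mxE.
have mxN p q (A : 'M[R]_(p, q)) i j : (- A) i j = - A i j by rewrite mxE.
rewrite !(mxD, mxN) connE {connE}.
have -> : ((\row_j \sum_i (delta_mx 0 a : 'rV[R]_n) 0 i * pd i (fun y => (Z *m conn_mx G Z y) 0 j) x) : 'rV[R]_n) 0 k
    = (\matrix_(a, k) pd a (fun y => (Z *m conn_mx G Z y) 0 k) x : 'M[R]_n) a k.
  by rewrite !mxE sumd.
have -> : ((\row_j \sum_i Z 0 i * pd i (fun y => ((delta_mx 0 a : 'rV[R]_n) *m conn_mx G Z y) 0 j) x) : 'rV[R]_n) 0 k
    = (\matrix_(a, k) \sum_b Z 0 b * pd b (fun y => conn_mx G Z y a k) x : 'M[R]_n) a k.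
  by rewrite !mxE; apply: eq_bigr => i _; rewrite pdE.
by rewrite deltaE [row _ _ _ _]mxE opprD addrACA addrA.
Qed.

(** This is R(Z,Z)Z = 0: the quadratic terms cancel by symmetry, and both derivative terms
    differentiate D_Z Z along [Z]. It is used for the extension, to get Z J = 0, and for [D], to get
    [X *m E = 0]. *)
Lemma mul_jacobi_self G x Z : (forall a b k, G a b k x = G b a k x) ->
  (forall a b k i, derivable (G a b k) x (delta_mx 0 i)) ->
  Z *m jacobi G x Z = 0.
Proof.
move=> Gsym dG; rewrite jacobi_conn_mx // mulmxBr mulmxDr.
rewrite (mul_conn_mxC _ Z) // mulmxA addrK mulmxBr.
apply/rowP => k; rewrite !mxE.
have dconn a b : is_derive x (delta_mx 0 b) (fun y => conn_mx G Z y a k)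
    (pd b (fun y => conn_mx G Z y a k) x).
  apply: derivableP.
  rewrite (_ : (fun y => _) = fun y => \sum_c Z 0 c * G a c k y).
    suff h : is_derive x (delta_mx 0 b) (fun y => \sum_c Z 0 c * G a c k y)
      (\sum_c Z 0 c * 'D_(delta_mx 0 b) (G a c k) x) by [].
    by apply: is_derive_bigsum => c; apply: is_derive_scale; exact: derivableP.
  by apply/funext => y; rewrite mxE.
rewrite [X in X - _](_ : _ = \sum_a \sum_b Z 0 a * (Z 0 b * pd a (fun y => conn_mx G Z y b k) x)).
  rewrite exchange_big /= -sumrB big1 // => a _; apply/eqP; rewrite subr_eq0; apply/eqP.
  by rewrite mxE mulr_sumr; apply: eq_bigr => b _; ring.
apply: eq_bigr => a _; rewrite mxE -mulr_sumr; congr (_ * _).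
rewrite (_ : (fun y => _) = fun y => \sum_b Z 0 b * conn_mx G Z y b k); last first.
  by apply/funext => y; rewrite mxE.
by apply: derive_val; apply: is_derive_bigsum => b; apply: is_derive_scale.
Qed.

(** Only the values and first derivatives of the coefficients at [x] enter. This allows a
    Levi-Civita connection to be replaced by a formula valid merely near the point. *)
Lemma jacobi_near G G' x Z :
  (forall a b k, G a b k x = G b a k x) ->
  (forall a b k, \near x, G a b k x = G' a b k x) -> jacobi G x Z = jacobi G' x Z.
Proof.
move=> Gsym GG'.
have GG'x a b k : G a b k x = G' a b k x by exact: nbhs_singleton (GG' a b k).
have connE W a k : \near x, conn_mx G W x a k = conn_mx G' W x a k.
  have : \forall y \near x, forall b, G a b k y = G' a b k y.
    have h := (@filter_forall _ _ (fun b y => G a b k y = G' a b k y) (nbhs x) _ (fun b => GG' a b k)).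
    exact: h.
  by apply: filterS => y E; rewrite !mxE; apply: eq_bigr => b _; rewrite E.
have connx W : conn_mx G W x = conn_mx G' W x.
  by apply/matrixP => a k; exact: nbhs_singleton (connE W a k).
rewrite !jacobi_conn_mx //; last by move=> a b k; rewrite -!GG'x.
rewrite !connx.
have -> : \matrix_(a, k) pd a (fun y => (Z *m conn_mx G Z y) 0 k) x =
    \matrix_(a, k) pd a (fun y => (Z *m conn_mx G' Z y) 0 k) x.
  apply/matrixP => a k; rewrite !mxE; apply: near_eq_derive.
  have : \forall y \near x, forall b, conn_mx G Z y b k = conn_mx G' Z y b k.
    have h := @filter_forall _ _ (fun b y => conn_mx G Z y b k = conn_mx G' Z y b k) (nbhs x) _
      (fun b => connE Z b k).
    exact: h.
  by apply: filterS => y E; rewrite !mxE; apply: eq_bigr => b _; rewrite E.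
have -> // : \matrix_(a, k) (\sum_b Z 0 b * pd b (fun y => conn_mx G Z y a k) x) =
    \matrix_(a, k) \sum_b Z 0 b * pd b (fun y => conn_mx G' Z y a k) x.
apply/matrixP => a k; rewrite !mxE; apply: eq_bigr => b _.
by rewrite /pd (near_eq_derive _ (connE Z a k)).
Qed.

End Jacobi.

(** * The Levi-Civita connection of the modified extension *)

Lemma sum_delta (F : pzSemiRingType) (n : nat) (f : 'I_n -> F) (k : 'I_n) :
  \sum_c f c * (c == k)%:R = f k.
Proof.
rewrite (bigD1 k) //= eqxx mulr1 big1 ?addr0 // => c /negPf->.
by rewrite mulr0.
Qed.

Lemma split_lshiftE (m n : nat) (i : 'I_m) : fintype.split (lshift n i) = inl i.
Proof. exact: (unsplitK (inl i)). Qed.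

Lemma split_rshiftE (m n : nat) (i : 'I_n) : fintype.split (rshift m i) = inr i.
Proof. exact: (unsplitK (inr i)). Qed.

Section Extension.
Variables (R : realType) (n : nat) (D : christoffel R n).

Definition ext_quad (i j : 'I_n) (z : 'rV[R]_(n + n)) : R :=
  rsubmx z 0 i * rsubmx z 0 j - 2 * \sum_k rsubmx z 0 k * D i j k (lsubmx z).

Definition ext_metric (z : 'rV[R]_(n + n)) : 'M[R]_(n + n) :=
  block_mx (\matrix_(i, j) ext_quad i j z) 1%:M 1%:M 0.

(* The projective change of D by the 1-form - p / 2; these are the coefficients
   Gamma_ij^k of the extension, and up to sign its Gamma_ij'^k'. *)
Definition base_conn : 'I_n -> 'I_n -> 'I_n -> 'rV[R]_(n + n) -> R := fun a b k z =>
  D a b k (lsubmx z) - 2^-1 * ((a == k)%:R * rsubmx z 0 b + (b == k)%:R * rsubmx z 0 a).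

(** The [inl] indices are base coordinates, the [inr] indices fibre coordinates. A vertical input
    never has a horizontal output: the vertical distribution is parallel. In the second case, the
    sum with derivatives of [D] is a symbol of the first kind up to sign, and the sum with
    [ext_quad] comes from the lower right block of the inverse metric. *)
Definition ext_conn : christoffel R (n + n) := fun i j k z =>
  match fintype.split i, fintype.split j, fintype.split k with
  | inl a, inl b, inl l => base_conn a b l z
  | inl a, inl b, inr l =>
      - (\sum_m rsubmx z 0 m * (pd a (D b l m) (lsubmx z) + pd b (D a l m) (lsubmx z)
                                - pd l (D a b m) (lsubmx z)))
      - \sum_m ext_quad l m z * base_conn a b m z
  | inl a, inr b, inr l => - base_conn l a b z
  | inr a, inl b, inr l => - base_conn l b a z
  | _, _, _ => 0
  end.

(** Second order is included because [ext_conn] already contains first derivatives of [D], and its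
    curvature differentiates them again. *)
Definition derivable_at (x : 'rV[R]_n) :=
  (forall i j k v, derivable (D i j k) x v) /\
  (forall a i j k v, derivable (pd a (D i j k)) x v).

Definition symmetric_at (x : 'rV[R]_n) := forall i j k, D i j k x = D j i k x.

Lemma is_derive_ext_quad i j z v : derivable_at (lsubmx z) ->
  is_derive z v (ext_quad i j)
    (rsubmx z 0 i * rsubmx v 0 j + rsubmx v 0 i * rsubmx z 0 j
     - 2 * \sum_k (rsubmx z 0 k * 'D_(lsubmx v) (D i j k) (lsubmx z)
                   + rsubmx v 0 k * D i j k (lsubmx z))).
Proof.
case=> dD _; apply: is_derive_add.
  by apply: is_derive_mul; exact: is_derive_rsubmx.
apply: is_derive_opp; apply: is_derive_scale; apply: is_derive_bigsum => k.
apply: is_derive_mul; first exact: is_derive_rsubmx.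
by apply: is_derive_lsubmx; exact: derivableP.
Qed.

Lemma lsubmx_delta_l (a : 'I_n) : lsubmx (delta_mx 0 (lshift n a) : 'rV[R]_(n + n)) = delta_mx 0 a.
Proof. by apply/rowP => j; rewrite !mxE (inj_eq (@lshift_inj _ _)). Qed.

Lemma lsubmx_delta_r (a : 'I_n) : lsubmx (delta_mx 0 (rshift n a) : 'rV[R]_(n + n)) = 0.
Proof. by apply/rowP => j; rewrite !mxE eq_lrshift andbF. Qed.

Lemma rsubmx_delta_l (a : 'I_n) : rsubmx (delta_mx 0 (lshift n a) : 'rV[R]_(n + n)) = 0.
Proof. by apply/rowP => j; rewrite !mxE eq_rlshift andbF. Qed.

Lemma rsubmx_delta_r (a : 'I_n) : rsubmx (delta_mx 0 (rshift n a) : 'rV[R]_(n + n)) = delta_mx 0 a.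
Proof. by apply/rowP => j; rewrite !mxE (inj_eq (@rshift_inj _ _)). Qed.

Lemma pd_ext_quad_l a i j z : derivable_at (lsubmx z) ->
  pd (lshift n a) (ext_quad i j) z = - 2 * \sum_k rsubmx z 0 k * pd a (D i j k) (lsubmx z).
Proof.
move=> dD; have := is_derive_ext_quad i j (delta_mx 0 (lshift n a)) dD.
case=> _; rewrite /pd => ->.
rewrite lsubmx_delta_l rsubmx_delta_l !mxE mulr0 mul0r !add0r mulNr.
by congr (- (_ * _)); apply: eq_bigr => k _; rewrite !mxE mul0r addr0.
Qed.

Lemma pd_ext_quad_r a i j z : derivable_at (lsubmx z) ->
  pd (rshift n a) (ext_quad i j) z =
  rsubmx z 0 i * (j == a)%:R + (i == a)%:R * rsubmx z 0 j - 2 * D i j a (lsubmx z).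
Proof.
move=> dD; have := is_derive_ext_quad i j (delta_mx 0 (rshift n a)) dD.
case=> _; rewrite /pd => ->.
rewrite lsubmx_delta_r rsubmx_delta_r.
have deltaE k : (delta_mx 0 a : 'rV[R]_n) 0 k = (k == a)%:R by rewrite mxE.
rewrite !deltaE -[in RHS](sum_delta (fun k => D i j k (lsubmx z))).
by congr (_ - _ * _); apply: eq_bigr => k _; rewrite derive0 mulr0 add0r deltaE mulrC.
Qed.

Lemma invmx_ext_metric z :
  invmx (ext_metric z) = block_mx 0 1%:M 1%:M (- \matrix_(i, j) ext_quad i j z).
Proof.
set B := block_mx 0 _ _ _.
have gB : ext_metric z *m B = 1%:M.
  rewrite mulmx_block !mul1mx !mulmx1 !mulmx0 !mul0mx !addr0 !add0r subrr.
  by rewrite -scalar_mx_block.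
by rewrite -[LHS]mulmx1 -gB mulKmx //; case/mulmx1_unit: gB.
Qed.

Lemma ext_metric_ll j l : (fun z => ext_metric z (lshift n j) (lshift n l)) = ext_quad j l.
Proof. by apply/funext => z; rewrite block_mxEul mxE. Qed.

Lemma ext_metric_lr j l : (fun z => ext_metric z (lshift n j) (rshift n l)) = fun _ => (j == l)%:R.
Proof. by apply/funext => z; rewrite block_mxEur mxE. Qed.

Lemma ext_metric_rl j l : (fun z => ext_metric z (rshift n j) (lshift n l)) = fun _ => (j == l)%:R.
Proof. by apply/funext => z; rewrite block_mxEdl mxE. Qed.

Lemma ext_metric_rr j l : (fun z => ext_metric z (rshift n j) (rshift n l)) = fun _ => 0.
Proof. by apply/funext => z; rewrite block_mxEdr mxE. Qed.

Definition ext_metricE := (ext_metric_ll, ext_metric_lr, ext_metric_rl, ext_metric_rr).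

Lemma ext_quadC i j z : symmetric_at (lsubmx z) -> ext_quad i j z = ext_quad j i z.
Proof.
move=> Dsym; rewrite /ext_quad (mulrC (rsubmx z 0 i)); congr (_ - _ * _).
by apply: eq_bigr => k _; rewrite Dsym.
Qed.

Lemma base_connC a b k z : symmetric_at (lsubmx z) -> base_conn a b k z = base_conn b a k z.
Proof. by move=> Dsym; rewrite /base_conn Dsym [X in _ * X]addrC. Qed.

(** Symmetry of [D] is assumed near the point, since the all-horizontal inputs with vertical output
    involve derivatives of [D]. *)
Lemma ext_conn_sym z : (\forall x \near lsubmx z, symmetric_at x) ->
  forall i j k, ext_conn i j k z = ext_conn j i k z.
Proof.
move=> near_sym; have Dsym : symmetric_at (lsubmx z) by exact: nbhs_singleton near_sym.
move=> i j k; rewrite /ext_conn.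
case: (fintype.split i) => a; case: (fintype.split j) => b; case: (fintype.split k) => l //.
  exact: base_connC.
congr (- _ - _); apply: eq_bigr => m _; last by rewrite base_connC.
rewrite [pd a _ _ + _]addrC; congr (_ * (_ - _)); apply: near_eq_derive.
by apply: filterS near_sym => x; apply.
Qed.

(** The inverse metric exchanges the two halves of the indices, up to a correction by [ext_quad]:
    [up] and [dn] express how it raises an index. Only [ext_quad] has nonzero derivatives, which
    settles the eight index patterns. *)
Lemma levi_civita_ext z : symmetric_at (lsubmx z) -> derivable_at (lsubmx z) ->
  forall i j k, levi_civita ext_metric i j k z = ext_conn i j k z.
Proof.
move=> Dsym dD.
have sum1 (f : 'I_n -> R) k : \sum_l (1%:M : 'M[R]_n) k l * f l = f k.
  by rewrite -(sum_delta f); apply: eq_bigr => l _; rewrite mxE eq_sym mulrC.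
have up (f : 'I_(n + n) -> R) k :
    \sum_l invmx (ext_metric z) (lshift n k) l * f l = f (rshift n k).
  rewrite invmx_ext_metric big_split_ord /= big1 ?add0r => [|l _]; last first.
    by rewrite block_mxEul mxE mul0r.
  by rewrite -[RHS](sum1 (fun l => f (rshift n l))); apply: eq_bigr => l _; rewrite block_mxEur.
have dn (f : 'I_(n + n) -> R) k :
    \sum_l invmx (ext_metric z) (rshift n k) l * f l =
    f (lshift n k) - \sum_l ext_quad k l z * f (rshift n l).
  rewrite invmx_ext_metric big_split_ord /= -sumrN; congr (_ + _).
    by rewrite -[RHS](sum1 (fun l => f (lshift n l))); apply: eq_bigr => l _; rewrite block_mxEdl.
  by apply: eq_bigr => l _; rewrite block_mxEdr !mxE mulNr.
move=> i j k; rewrite /levi_civita /ext_conn.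
(* A fibre derivative of [ext_quad] produces the Kronecker terms of the projective change together
   with [- 2 * D a b l]. *)
have base a b l : 2^-1 * (0 + 0 - pd (rshift n l) (ext_quad a b) z) = base_conn a b l z.
  by rewrite pd_ext_quad_r // /base_conn; field.
have base0 a b l : 2^-1 * pd (rshift n l) (ext_quad a b) z = - base_conn a b l z.
  by rewrite -base; ring.
case: (split_ordP i) => a ->; case: (split_ordP j) => b ->; case: (split_ordP k) => l ->;
  rewrite ?split_lshiftE ?split_rshiftE ?up ?dn ?ext_metricE ?pd_cst.
- by rewrite base.
- rewrite mulrBr !pd_ext_quad_l //; congr (_ - _).
    rewrite -!mulrDr -mulrBr mulNr mulrN mulrA mulVf // mul1r.
    rewrite -!big_split -sumrN -big_split /=; congr (- _).
    by apply: eq_bigr => m _; ring.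
  rewrite mulr_sumr; apply: eq_bigr => m _.
  by rewrite !ext_metricE !pd_cst mulrCA base.
- by rewrite !addr0 subrr mulr0.
- rewrite big1 => [|m _]; last by rewrite !ext_metricE !pd_cst !addr0 subrr mulr0.
  by rewrite !add0r !subr0 base0 base_connC.
- by rewrite !addr0 subrr mulr0.
- rewrite big1 => [|m _]; last by rewrite !ext_metricE !pd_cst !addr0 subrr mulr0.
  by rewrite !addr0 !subr0 base0 base_connC.
- by rewrite !addr0 subrr mulr0.
- rewrite big1 => [|m _]; last by rewrite !ext_metricE !pd_cst !addr0 subrr mulr0.
  by rewrite !addr0 !subr0 mulr0.
Qed.

End Extension.

(** * The connection of the extension in block form *)

Section ExtJacobi.
Variables (R : realType) (n : nat) (D : christoffel R n).
Implicit Types (X w : 'rV[R]_n) (z : 'rV[R]_(n + n)).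

(** The counterpart of [conn_mx] for [base_conn], as [sum_base_conn] confirms; matrix notation makes
    the later products computable. *)
Definition base_conn_mx X z : 'M[R]_n := conn_mx D X (lsubmx z) -
  2^-1 *: (((rsubmx z *m X^T) 0 0)%:M + (rsubmx z)^T *m X).

Lemma base_conn_mxE X z a k :
  base_conn_mx X z a k = conn_mx D X (lsubmx z) a k -
    2^-1 * ((\sum_c rsubmx z 0 c * X 0 c) * (a == k)%:R + rsubmx z 0 a * X 0 k).
Proof.
have PE : (rsubmx z *m X^T) 0 0 = \sum_c rsubmx z 0 c * X 0 c.
  by rewrite mxE; apply: eq_bigr => c _; rewrite [X^T _ _]mxE.
rewrite /base_conn_mx PE; set N := conn_mx _ _ _; set P := \sum_c _.
by rewrite !mxE big_ord1 !mxE mulr_natr.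
Qed.

Lemma sum_base_conn X z a k : \sum_c X 0 c * base_conn D a c k z = base_conn_mx X z a k.
Proof.
rewrite base_conn_mxE mxE -[X 0 k](sum_delta (fun c => X 0 c)) !mulr_sumr mulr_suml.
rewrite -big_split mulr_sumr -sumrB; apply: eq_bigr => c _.
by rewrite /base_conn /=; ring.
Qed.

(** Rewrite rules for the eight index patterns, stated as equalities of functions so that they also
    apply inside [derivable]. *)
Lemma ext_connE a b k : (ext_conn D (lshift n a) (lshift n b) (lshift n k) = base_conn D a b k) *
  (ext_conn D (lshift n a) (rshift n b) (rshift n k) = fun z => - base_conn D k a b z) *
  (ext_conn D (rshift n a) (lshift n b) (rshift n k) = fun z => - base_conn D k b a z) *
  (ext_conn D (lshift n a) (rshift n b) (lshift n k) = fun=> 0) *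
  (ext_conn D (rshift n a) (lshift n b) (lshift n k) = fun=> 0) *
  (ext_conn D (rshift n a) (rshift n b) (lshift n k) = fun=> 0) *
  (ext_conn D (rshift n a) (rshift n b) (rshift n k) = fun=> 0) *
  (ext_conn D (lshift n a) (lshift n b) (rshift n k) = fun z => 
      - (\sum_m rsubmx z 0 m * (pd a (D b k m) (lsubmx z) + pd b (D a k m) (lsubmx z)
                                - pd k (D a b m) (lsubmx z)))
      - \sum_m ext_quad D k m z * base_conn D a b m z).
Proof. by do !split; apply/funext => z; rewrite /ext_conn ?split_lshiftE ?split_rshiftE. Qed.

Lemma conn_mx_extE X w z i k : conn_mx (ext_conn D) (row_mx X w) z i k =
  \sum_b X 0 b * ext_conn D i (lshift n b) k z + \sum_b w 0 b * ext_conn D i (rshift n b) k z.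
Proof.
rewrite mxE big_split_ord /=.
by congr (_ + _); apply: eq_bigr => b _; rewrite ?row_mxEl ?row_mxEr.
Qed.

(** The zero block says that the vertical distribution is parallel. The upper right block is
    deliberately left unevaluated, as it only contributes to the block [S]. *)
Lemma conn_mx_ext X w z : conn_mx (ext_conn D) (row_mx X w) z =
  block_mx (base_conn_mx X z) (ursubmx (conn_mx (ext_conn D) (row_mx X w) z))
    0 (- (base_conn_mx X z)^T).
Proof.
rewrite -[LHS]submxK; congr block_mx; apply/matrixP => a k; rewrite [LHS]mxE [LHS]mxE conn_mx_extE.
- rewrite [X in _ + X]big1 => [|c _]; last by rewrite ext_connE mulr0.
  by rewrite addr0 -sum_base_conn; apply: eq_bigr => c _; rewrite ext_connE.
- by rewrite !big1 ?addr0 ?mxE // => c _; rewrite ext_connE mulr0.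
- rewrite [X in _ + X]big1 => [|c _]; last by rewrite ext_connE mulr0.
  rewrite addr0 [RHS]mxE [X in - X]mxE -sum_base_conn -sumrN.
  by apply: eq_bigr => c _; rewrite ext_connE mulrN.
Qed.

(* - sum_m p_m quad_deriv X m k is the Christoffel symbol of the first kind
   Gamma_ab,k contracted twice with X. *)
Definition quad_deriv X m k x : R := \sum_a \sum_b X 0 a * X 0 b *
  (pd a (D b k m) x + pd b (D a k m) x - pd k (D a b m) x).

(** These are the components of D_Z Z for constant Z. The fibre part is needed explicitly, because
    its fibre derivatives enter the lower right block of the Jacobi operator. Its factor 2 collects
    the two mixed contributions of horizontal and vertical inputs. *)
Lemma mul_conn_mx_ext X w z :
  row_mx X w *m conn_mx (ext_conn D) (row_mx X w) z =
  row_mx (X *m base_conn_mx X z) (\row_k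
    (- (\sum_m rsubmx z 0 m * quad_deriv X m k (lsubmx z))
     - \sum_m ext_quad D k m z * (X *m base_conn_mx X z) 0 m
     - 2 * (w *m (base_conn_mx X z)^T) 0 k)).
Proof.
rewrite [in LHS]conn_mx_ext mul_row_block mulmx0 addr0; congr row_mx.
apply/rowP => k; rewrite mulmxN !mxE.
have -> : \sum_j X 0 j * ursubmx (conn_mx (ext_conn D) (row_mx X w) z) j k =
    - (\sum_m rsubmx z 0 m * quad_deriv X m k (lsubmx z))
    - \sum_m ext_quad D k m z * (X *m base_conn_mx X z) 0 m
    - (w *m (base_conn_mx X z)^T) 0 k.
  rewrite !mxE.
  have -> : \sum_m ext_quad D k m z * (X *m base_conn_mx X z) 0 m =
      \sum_a X 0 a * \sum_b X 0 b * \sum_m ext_quad D k m z * base_conn D a b m z.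
    under [RHS]eq_bigr => a _.
      under eq_bigr => b _ do rewrite mulr_sumr.
      rewrite exchange_big /= mulr_sumr.
      over.
    rewrite [RHS]exchange_big /=; apply: eq_bigr => m _.
    rewrite mxE mulr_sumr; apply: eq_bigr => a _; rewrite -sum_base_conn !mulr_sumr.
    by apply: eq_bigr => b _; ring.
  have -> : \sum_m rsubmx z 0 m * quad_deriv X m k (lsubmx z) =
      \sum_a X 0 a * \sum_b X 0 b * \sum_m rsubmx z 0 m *
        (pd a (D b k m) (lsubmx z) + pd b (D a k m) (lsubmx z) - pd k (D a b m) (lsubmx z)).
    under [RHS]eq_bigr => a _.
      under eq_bigr => b _ do rewrite mulr_sumr.
      rewrite exchange_big /= mulr_sumr.
      over.
    rewrite [RHS]exchange_big /=; apply: eq_bigr => m _.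
    rewrite mulr_sumr; apply: eq_bigr => a _; rewrite !mulr_sumr.
    by apply: eq_bigr => b _; ring.
  have -> : \sum_j w 0 j * (base_conn_mx X z)^T j k = 
      \sum_a X 0 a * \sum_b w 0 b * base_conn D k a b z.
    under [RHS]eq_bigr => a _ do rewrite mulr_sumr.
    rewrite exchange_big /=; apply: eq_bigr => b _; rewrite mxE -sum_base_conn mulr_sumr.
    by apply: eq_bigr => a _; ring.
  rewrite -!sumrN -!big_split; apply: eq_bigr => a _ /=.
  have -> : ursubmx (conn_mx (ext_conn D) (row_mx X w) z) a k =
      conn_mx (ext_conn D) (row_mx X w) z (lshift n a) (rshift n k) by rewrite mxE mxE.
  rewrite conn_mx_extE -!mulrN -!mulrDr; congr (_ * (_ + _)).
    by rewrite -!sumrN -big_split; apply: eq_bigr => b _; rewrite ext_connE /=; ring.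
  by rewrite -sumrN; apply: eq_bigr => b _; rewrite ext_connE mulrN.
by rewrite mxE; ring.
Qed.

End ExtJacobi.

Lemma is_derive_derivable (R : realType) (V : normedModType R) (f : V -> R) (x v : V) (df : R) :
  is_derive x v f df -> derivable f x v.
Proof. by case. Qed.

(** * Differentiation of the blocks and the Jacobi operator of the extension *)

Section ExtJacobiBlocks.
Variables (R : realType) (n : nat) (D : christoffel R n).
Implicit Types (X Y w : 'rV[R]_n) (z v : 'rV[R]_(n + n)).

Lemma is_derive_conn_mx X (x u : 'rV[R]_n) a k : derivable_at D x ->
  is_derive x u (fun y => conn_mx D X y a k) (\sum_c X 0 c * 'D_u (D a c k) x).
Proof.
case=> dD _; rewrite (_ : (fun y => _) = fun y => \sum_c X 0 c * D a c k y).
  by apply: is_derive_bigsum => c; apply: is_derive_scale; exact: derivableP.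
by apply/funext => y; rewrite mxE.
Qed.

Definition conn_deriv X (u x : 'rV[R]_n) : 'M[R]_n :=
  \matrix_(a, k) \sum_c X 0 c * 'D_u (D a c k) x.

(** The derivative of [base_conn_mx D X] at [z] along [v]: the projective term is linear in the
    fibre coordinate, so there [rsubmx v] simply replaces [rsubmx z]. *)
Definition base_deriv X z v : 'M[R]_n := conn_deriv X (lsubmx v) (lsubmx z) -
  2^-1 *: (((rsubmx v *m X^T) 0 0)%:M + (rsubmx v)^T *m X).

Lemma is_derive_base_conn_mx X z v a k : derivable_at D (lsubmx z) ->
  is_derive z v (fun y => base_conn_mx D X y a k) (base_deriv X z v a k).
Proof.
move=> dD.
rewrite (_ : (fun y => _) = fun y : 'rV[R]_(n + n) => conn_mx D X (lsubmx y) a k -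
    2^-1 * ((\sum_c rsubmx y 0 c * X 0 c) * (a == k)%:R + rsubmx y 0 a * X 0 k)); last first.
  by apply/funext => y; rewrite base_conn_mxE.
have -> : base_deriv X z v a k = \sum_c X 0 c * 'D_(lsubmx v) (D a c k) (lsubmx z) -
    2^-1 * ((\sum_c rsubmx v 0 c * X 0 c) * (a == k)%:R + rsubmx v 0 a * X 0 k).
  have PE : (rsubmx v *m X^T) 0 0 = \sum_c rsubmx v 0 c * X 0 c.
    by rewrite mxE; apply: eq_bigr => c _; rewrite [X^T _ _]mxE.
  rewrite /base_deriv PE; set P := \sum_c rsubmx v 0 c * _.
  by rewrite !mxE big_ord1 !mxE mulr_natr.
apply: is_derive_add.
  apply: (is_derive_lsubmx (f := fun y => conn_mx D X y a k)).
  exact: is_derive_conn_mx.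
apply: is_derive_opp; apply: is_derive_scale; apply: is_derive_add.
  apply: is_derive_scaler; apply: is_derive_bigsum => c.
  by apply: is_derive_scaler; exact: is_derive_rsubmx.
by apply: is_derive_scaler; exact: is_derive_rsubmx.
Qed.

Lemma is_derive_mul_base Y X z v k : derivable_at D (lsubmx z) ->
  is_derive z v (fun y => (Y *m base_conn_mx D X y) 0 k) ((Y *m base_deriv X z v) 0 k).
Proof.
move=> dD; rewrite (_ : (fun y => _) = fun y => \sum_a Y 0 a * base_conn_mx D X y a k).
  rewrite mxE; apply: is_derive_bigsum => a; apply: is_derive_scale.
  exact: is_derive_base_conn_mx.
by apply/funext => y; rewrite mxE.
Qed.

Lemma is_derive_mul_baseT Y X z v k : derivable_at D (lsubmx z) ->
  is_derive z v (fun y => (Y *m (base_conn_mx D X y)^T) 0 k) ((Y *m (base_deriv X z v)^T) 0 k).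
Proof.
move=> dD; rewrite (_ : (fun y => _) = fun y => \sum_a Y 0 a * base_conn_mx D X y k a).
  rewrite mxE; apply: is_derive_bigsum => a; rewrite mxE; apply: is_derive_scale.
  exact: is_derive_base_conn_mx.
by apply/funext => y; rewrite mxE; apply: eq_bigr => a _; rewrite mxE.
Qed.

Lemma base_deriv_l X z a : base_deriv X z (delta_mx 0 (lshift n a)) =
  conn_deriv X (delta_mx 0 a) (lsubmx z).
Proof.
rewrite /base_deriv lsubmx_delta_l rsubmx_delta_l mul0mx trmx0 mul0mx.
by rewrite [X in X%:M]mxE raddf0 addr0 scaler0 subr0.
Qed.

Lemma base_deriv_r X z a : base_deriv X z (delta_mx 0 (rshift n a)) =
  - 2^-1 *: ((X 0 a)%:M + (delta_mx 0 a)^T *m X).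
Proof.
rewrite /base_deriv lsubmx_delta_r rsubmx_delta_r scaleNr.
have -> : conn_deriv X 0 (lsubmx z) = 0.
  by apply/matrixP => i k; rewrite !mxE big1 // => c _; rewrite derive0 mulr0.
by rewrite sub0r -rowE mxE mxE.
Qed.

Lemma base_deriv_rE X z a i k : base_deriv X z (delta_mx 0 (rshift n a)) i k =
  - 2^-1 * (X 0 a * (i == k)%:R + (i == a)%:R * X 0 k).
Proof.
rewrite base_deriv_r !mxE big_ord1 -[_ *+ (i == k)]mulr_natr.
by rewrite [(delta_mx _ _)^T _ _]mxE [delta_mx _ _ _ _]mxE eqxx.
Qed.

(** The two halves of the projective term contribute equally. This is the source of the block
    [- (X^T *m X)]. *)
Lemma mul_base_deriv_r X z a m :
  (X *m base_deriv X z (delta_mx 0 (rshift n a))) 0 m = - (X 0 a * X 0 m).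
Proof.
transitivity (- 2^-1 * (X 0 a * (\sum_i X 0 i * (i == m)%:R)
    + (\sum_i X 0 i * (i == a)%:R) * X 0 m)); last by rewrite !sum_delta; field.
rewrite mxE mulr_sumr mulr_suml -big_split mulr_sumr; apply: eq_bigr => i _ /=.
by rewrite base_deriv_rE; ring.
Qed.

Lemma mul_base_deriv_rT w X z a k :
  (w *m (base_deriv X z (delta_mx 0 (rshift n a)))^T) 0 k =
  - 2^-1 * (X 0 a * w 0 k + (k == a)%:R * (w *m X^T) 0 0).
Proof.
transitivity (- 2^-1 * (X 0 a * (\sum_i w 0 i * (i == k)%:R)
    + (k == a)%:R * \sum_i w 0 i * X 0 i)); last first.
  rewrite sum_delta mxE; congr (_ * (_ + _ * _)).
  by apply: eq_bigr => i _; rewrite [X^T _ _]mxE.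
rewrite mxE !mulr_sumr -big_split mulr_sumr; apply: eq_bigr => i _ /=.
by rewrite mxE base_deriv_rE (eq_sym k i); ring.
Qed.

Lemma derivable_base_conn z v a b k : derivable_at D (lsubmx z) ->
  derivable (base_conn D a b k) z v.
Proof.
case=> dD _; apply: (@ex_derive _ _ _ _ _ _ ('D_(lsubmx v) (D a b k) (lsubmx z) -
  2^-1 * ((a == k)%:R * rsubmx v 0 b + (b == k)%:R * rsubmx v 0 a))).
apply: is_derive_add; first by apply: is_derive_lsubmx; exact: derivableP.
apply: is_derive_opp; apply: is_derive_scale.
by apply: is_derive_add; apply: is_derive_scale; exact: is_derive_rsubmx.
Qed.

Lemma derivable_ext_conn z v i j k : derivable_at D (lsubmx z) ->
  derivable (ext_conn D i j k) z v.
Proof.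
move=> dD; have dbase a b l : is_derive z v (base_conn D a b l) ('D_v (base_conn D a b l) z).
  by apply: derivableP; exact: derivable_base_conn.
case: (split_ordP i) => a ->; case: (split_ordP j) => b ->; case: (split_ordP k) => l ->;
  rewrite ext_connE.
- exact: is_derive_derivable (dbase _ _ _).
- have dpd c i' j' m : is_derive z v (fun y => pd c (D i' j' m) (lsubmx y))
      ('D_(lsubmx v) (pd c (D i' j' m)) (lsubmx z)).
    by apply: is_derive_lsubmx; apply: derivableP; exact: dD.2.
  have h1 : derivable (fun y => \sum_m rsubmx y 0 m * (pd a (D b l m) (lsubmx y)
      + pd b (D a l m) (lsubmx y) - pd l (D a b m) (lsubmx y))) z v.
    have h m := is_derive_add (is_derive_add (dpd a b l m) (dpd b a l m)) (is_derive_opp (dpd l a b m)).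
    apply: is_derive_derivable; apply: is_derive_bigsum => m.
    exact: is_derive_mul (is_derive_rsubmx _ _ _) (h m).
  have h2 : derivable (fun y => \sum_m ext_quad D l m y * base_conn D a b m y) z v.
    apply: is_derive_derivable; apply: is_derive_bigsum => m; exact: is_derive_mul (is_derive_ext_quad l m v dD) (dbase a b m).
  exact: is_derive_derivable (is_derive_add (is_derive_opp (derivableP h1)) (is_derive_opp (derivableP h2))).
- exact: derivable_cst.
- exact: is_derive_derivable (is_derive_opp (dbase _ _ _)).
- exact: derivable_cst.
- exact: is_derive_derivable (is_derive_opp (dbase _ _ _)).
- exact: derivable_cst.
- exact: derivable_cst.
Qed.

(** With [grad_dir] below, these are the two derivative terms of [jacobi_conn_mx] for [D]: the
    gradient of D_X X, and the derivative of the connection matrix along [X]. *)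
Definition grad_row X (x : 'rV[R]_n) : 'M[R]_n :=
  \matrix_(a, k) pd a (fun y => (X *m conn_mx D X y) 0 k) x.

Definition grad_dir X (x : 'rV[R]_n) : 'M[R]_n :=
  \matrix_(a, k) \sum_b X 0 b * pd b (fun y => conn_mx D X y a k) x.

Lemma pd_conn_mx X x a b k : derivable_at D x ->
  pd b (fun y => conn_mx D X y a k) x = \sum_c X 0 c * pd b (D a c k) x.
Proof. by move=> dD; case: (is_derive_conn_mx X (delta_mx 0 b) a k dD). Qed.

Lemma grad_rowE X x a k : derivable_at D x ->
  grad_row X x a k = \sum_b \sum_c X 0 b * X 0 c * pd a (D b c k) x.
Proof.
move=> dD; rewrite mxE (_ : (fun y => _) = fun y => \sum_b X 0 b * conn_mx D X y b k).
  have h : is_derive x (delta_mx 0 a) (fun y => \sum_b X 0 b * conn_mx D X y b k)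
      (\sum_b X 0 b * \sum_c X 0 c * pd a (D b c k) x).
    by apply: is_derive_bigsum => b; apply: is_derive_scale; exact: is_derive_conn_mx.
  case: h => _; rewrite /pd => ->; apply: eq_bigr => b _; rewrite mulr_sumr.
  by apply: eq_bigr => c _; rewrite mulrA.
by apply/funext => y; rewrite mxE.
Qed.

Lemma grad_dirE X x a k : derivable_at D x ->
  grad_dir X x a k = \sum_b \sum_c X 0 b * X 0 c * pd b (D a c k) x.
Proof.
move=> dD; rewrite mxE; apply: eq_bigr => b _; rewrite pd_conn_mx // mulr_sumr.
by apply: eq_bigr => c _; rewrite mulrA.
Qed.

(** After contraction with [X] twice, the first two terms agree by symmetry of [D], and each is
    [grad_dir]. *)
Lemma quad_derivE X x m k : derivable_at D x -> (\forall y \near x, symmetric_at D y) ->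
  quad_deriv D X m k x = 2 * grad_dir X x k m - grad_row X x k m.
Proof.
move=> dD near_sym; rewrite grad_dirE // grad_rowE //.
have pdC c i j l : pd c (D i j l) x = pd c (D j i l) x.
  by apply: near_eq_derive; apply: filterS near_sym => y; apply.
rewrite mulrDl mul1r [X in _ + X - _]exchange_big /= -big_split -sumrB; apply: eq_bigr => a _.
rewrite -big_split -sumrB; apply: eq_bigr => b _ /=.
by rewrite (pdC a b) (pdC b a); ring.
Qed.

(* The covector a = X A. *)
Definition ext_row X z : 'rV[R]_n := X *m \matrix_(i, j) ext_quad D i j z.

(** Block by block evaluation of [jacobi_conn_mx]: [M1] is the gradient of D_Z Z, [M2] the
    derivative of the connection matrix along Z. The matrix [dir] is the derivative of
    [base_conn_mx D X] along Z. *)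
Lemma ext_jacobi_block X w z : derivable_at D (lsubmx z) ->
  (\forall x \near lsubmx z, symmetric_at D x) ->
  let dir := grad_dir X (lsubmx z) - 2^-1 *: (((w *m X^T) 0 0)%:M + w^T *m X) in
  let H := base_conn_mx D X z in
  let Hc := base_conn_mx D (X *m H) z in
  exists S, jacobi (ext_conn D) z (row_mx X w) = block_mx
    (grad_row X (lsubmx z) - dir + Hc - H *m H) S
    (- (X^T *m X))
    (X^T *m ext_row X z + (grad_row X (lsubmx z))^T - 2 *: (grad_dir X (lsubmx z))^T
     + ((w *m X^T) 0 0)%:M + X^T *m w + 2 *: Hc^T + dir^T - Hc^T - (H *m H)^T).
Proof.
move=> dD near_sym dir H Hc.
set Z := row_mx X w.
rewrite jacobi_conn_mx; last exact: ext_conn_sym.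
rewrite mul_conn_mx_ext conn_mx_ext -/H -/Hc.
set Cc := ursubmx _; rewrite conn_mx_ext -/H; set C := ursubmx _.
set M1 := \matrix_(_, _) pd _ _ _; set M2 := \matrix_(_, _) \sum_b _.
have pdl a b : pd b (fun y => conn_mx (ext_conn D) Z y (lshift n a.1) (lshift n a.2)) z =
    base_deriv X z (delta_mx 0 b) a.1 a.2.
  rewrite (_ : (fun y => _) = fun y => base_conn_mx D X y a.1 a.2).
    by case: (is_derive_base_conn_mx X (delta_mx 0 b) a.1 a.2 dD).
  by apply/funext => y; rewrite conn_mx_ext block_mxEul.
have pdr a b : pd b (fun y => conn_mx (ext_conn D) Z y (rshift n a.1) (rshift n a.2)) z =
    - base_deriv X z (delta_mx 0 b) a.2 a.1.
  rewrite (_ : (fun y => _) = fun y => - base_conn_mx D X y a.2 a.1).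
    by case: (is_derive_opp (is_derive_base_conn_mx X (delta_mx 0 b) a.2 a.1 dD)).
  by apply/funext => y; rewrite conn_mx_ext block_mxEdr !mxE.
(* The horizontal part of [Z] differentiates the coefficients of [D]; the vertical part
   differentiates the projective term, which replaces the fibre coordinate by [w]. *)
have dirE a k : \sum_b Z 0 b * base_deriv X z (delta_mx 0 b) a k = dir a k.
  rewrite big_split_ord /= [RHS]mxE; congr (_ + _).
    rewrite [RHS]mxE; apply: eq_bigr => b _; rewrite row_mxEl base_deriv_l pd_conn_mx //.
    by rewrite [conn_deriv _ _ _ _ _]mxE.
  have wX : (w *m X^T) 0 0 = \sum_b w 0 b * X 0 b.
    by rewrite mxE; apply: eq_bigr => b _; rewrite [X^T _ _]mxE.
  rewrite wX !mxE big_ord1 -[_ *+ (a == k)]mulr_natr mulr_suml [w^T _ _]mxE -(sum_delta (fun b => w 0 b) a).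
  rewrite mulr_suml -big_split /= mulr_sumr -sumrN; apply: eq_bigr => b _.
  rewrite row_mxEr base_deriv_r !mxE big_ord1 !mxE eqxx /= -mulr_natr (eq_sym b a); ring.
have M2E : M2 = block_mx dir (ursubmx M2) 0 (- dir^T).
  rewrite -[LHS]submxK; congr block_mx; apply/matrixP => a k; rewrite [LHS]mxE [LHS]mxE [LHS]mxE.
  - by rewrite -dirE; apply: eq_bigr => b _; rewrite (pdl (a, k)).
  - rewrite mxE big1 // => b _; rewrite (_ : (fun y => _) = fun=> 0) ?pd_cst ?mulr0 //.
    by apply/funext => y; rewrite conn_mx_ext block_mxEdl mxE.
  - rewrite 2!mxE -dirE -sumrN; apply: eq_bigr => b _; rewrite (pdr (a, k)).
    by rewrite mulrN.
have M1E : M1 = block_mx (grad_row X (lsubmx z)) (ursubmx M1) (- (X^T *m X))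
    (X^T *m ext_row X z + (grad_row X (lsubmx z))^T - 2 *: (grad_dir X (lsubmx z))^T
     + ((w *m X^T) 0 0)%:M + X^T *m w + 2 *: Hc^T).
  rewrite -[LHS]submxK; congr block_mx; apply/matrixP => a k; rewrite [LHS]mxE [LHS]mxE [LHS]mxE.
  - rewrite (_ : (fun y => _) = fun y => (X *m base_conn_mx D X y) 0 k); last first.
      by apply/funext => y; rewrite mul_conn_mx_ext row_mxEl.
    case: (is_derive_mul_base X X (delta_mx 0 (lshift n a)) k dD) => _; rewrite /pd => ->.
    rewrite base_deriv_l grad_rowE // mxE; apply: eq_bigr => b _.
    by rewrite mxE mulr_sumr; apply: eq_bigr => c _; rewrite mulrA.
  - rewrite (_ : (fun y => _) = fun y => (X *m base_conn_mx D X y) 0 k); last first.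
      by apply/funext => y; rewrite mul_conn_mx_ext row_mxEl.
    case: (is_derive_mul_base X X (delta_mx 0 (rshift n a)) k dD) => _; rewrite /pd => ->.
    by rewrite mul_base_deriv_r !mxE big_ord1 mxE.
  - rewrite (_ : (fun y => _) = fun y => - (\sum_m rsubmx y 0 m * quad_deriv D X m k (lsubmx y))
      - \sum_m ext_quad D k m y * (X *m base_conn_mx D X y) 0 m
      - 2 * (w *m (base_conn_mx D X y)^T) 0 k); last first.
      by apply/funext => y; rewrite mul_conn_mx_ext row_mxEr mxE.
    set v := delta_mx 0 (rshift n a) : 'rV[R]_(n + n).
    have d1 : is_derive z v (fun y => \sum_m rsubmx y 0 m * quad_deriv D X m k (lsubmx y))
        (\sum_m (rsubmx z 0 m * 0 + rsubmx v 0 m * quad_deriv D X m k (lsubmx z))).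
      apply: is_derive_bigsum => m; apply: is_derive_mul; first exact: is_derive_rsubmx.
      (* [quad_deriv] depends on the base point only, so its derivative along the fibre is zero. *)
      by apply: is_derive_lsubmx; rewrite lsubmx_delta_r; exact: is_derive0.
    have d2 : is_derive z v (fun y => \sum_m ext_quad D k m y * (X *m base_conn_mx D X y) 0 m)
        (\sum_m (ext_quad D k m z * (X *m base_deriv X z v) 0 m +
                  pd (rshift n a) (ext_quad D k m) z * (X *m H) 0 m)).
      apply: is_derive_bigsum => m; apply: is_derive_mul; last exact: is_derive_mul_base.
      by apply: derivableP; exact: is_derive_derivable (is_derive_ext_quad k m v dD).
    have d3 := is_derive_scale 2 (is_derive_mul_baseT w X v k dD).
    have [_] := is_derive_add (is_derive_add (is_derive_opp d1) (is_derive_opp d2)) (is_derive_opp d3).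
    rewrite /pd => ->; rewrite mul_base_deriv_rT.
    have -> : \sum_m (rsubmx z 0 m * 0 + rsubmx v 0 m * quad_deriv D X m k (lsubmx z)) =
        2 * grad_dir X (lsubmx z) k a - grad_row X (lsubmx z) k a.
      rewrite -quad_derivE // -[RHS](sum_delta (fun m => quad_deriv D X m k (lsubmx z))).
      by apply: eq_bigr => m _; rewrite mulr0 add0r rsubmx_delta_r [delta_mx _ _ _ _]mxE mulrC.
    have Dsym : symmetric_at D (lsubmx z) by exact: nbhs_singleton near_sym.
    (* The fibre derivative of [ext_quad] is [- 2] times [base_conn], which paired with [X *m H]
       gives [Hc]; the other factor, differentiated, gives [ext_row] by [mul_base_deriv_r]. *)
    have -> : \sum_m (ext_quad D k m z * (X *m base_deriv X z v) 0 m +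
                  pd (rshift n a) (ext_quad D k m) z * (X *m H) 0 m) =
        - (X 0 a * ext_row X z 0 k) - 2 * Hc k a.
      rewrite /Hc base_conn_mxE [conn_mx _ _ _ _ _]mxE [ext_row _ _ _ _]mxE; set W := X *m H.
      transitivity (\sum_m (- X 0 a * (X 0 m * ext_quad D m k z) - 2 * (W 0 m * D k m a (lsubmx z)
          - 2^-1 * (rsubmx z 0 m * W 0 m * (k == a)%:R + rsubmx z 0 k * (W 0 m * (m == a)%:R))))).
        apply: eq_bigr => m _; rewrite mul_base_deriv_r pd_ext_quad_r // (ext_quadC k m Dsym).
        by field.
      rewrite sumrB -!mulr_sumr sumrB -mulr_sumr big_split /= -mulr_suml -mulr_sumr sum_delta mulNr.
      congr (- (_ * _) - _); apply: eq_bigr => m _.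
      by rewrite [in RHS]mxE.
    move: (grad_row X _) (grad_dir X _) (ext_row X z) (Hc) ((w *m X^T) 0 0) => gr gd er h c.
    rewrite !mxE !big_ord1 !mxE -[_ *+ (a == k)]mulr_natr (eq_sym a k).
    by field.
exists (ursubmx M1 - ursubmx M2 + Cc - (H *m C + C *m - H^T)).
rewrite M1E M2E mulmx_block !opp_block_mx !add_block_mx !mulmx0 !mul0mx !oppr0 !addr0 !add0r.
congr block_mx.
- by rewrite !block_mxKur.
- by rewrite subr0.
- by rewrite mulNmx mulmxN !opprK trmx_mul.
Qed.

End ExtJacobiBlocks.

(** * The closed form of the Jacobi operator and its characteristic polynomial *)

Section Final.
Variables (R : realType) (n : nat) (D : christoffel R n).
Implicit Types (X w : 'rV[R]_n) (z : 'rV[R]_(n + n)).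

Lemma ext_rowE X z : symmetric_at D (lsubmx z) ->
  ext_row D X z = (rsubmx z *m X^T) 0 0 *: rsubmx z
    - 2 *: (rsubmx z *m (conn_mx D X (lsubmx z))^T).
Proof.
move=> Dsym; apply/rowP => k; rewrite mxE.
transitivity (\sum_j (rsubmx z 0 j * X 0 j * rsubmx z 0 k
   - 2 * \sum_m rsubmx z 0 m * (X 0 j * D k j m (lsubmx z)))).
  apply: eq_bigr => j _; rewrite [(\matrix_(_, _) _) _ _]mxE /ext_quad mulrBr.
  congr (_ - _); first by ring.
  rewrite [LHS]mulrCA; congr (_ * _); rewrite mulr_sumr; apply: eq_bigr => m _.
  by rewrite Dsym; ring.
rewrite sumrB -mulr_suml -mulr_sumr exchange_big /=; set p := rsubmx z.
have -> : \sum_j p 0 j * X 0 j = (p *m X^T) 0 0.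
  by rewrite mxE; apply: eq_bigr => j _; rewrite [X^T _ _]mxE.
have -> : \sum_m \sum_j p 0 m * (X 0 j * D k j m (lsubmx z)) =
    (p *m (conn_mx D X (lsubmx z))^T) 0 k.
  rewrite mxE; apply: eq_bigr => m _; rewrite -mulr_sumr; congr (_ * _).
  by rewrite mxE mxE.
by move: (p *m (conn_mx _ _ _)^T) (p *m X^T) => u v; move: p => q; rewrite !mxE.
Qed.

(* The terms of the curvature of [base_conn] without derivatives. *)
Lemma base_conn_curvature X z : symmetric_at D (lsubmx z) ->
  let G := conn_mx D X (lsubmx z) in
  base_conn_mx D (X *m base_conn_mx D X z) z - base_conn_mx D X z *m base_conn_mx D X z =
  conn_mx D (X *m G) (lsubmx z) - G *m G + (4^-1 * (ext_row D X z *m X^T) 0 0)%:M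
  - 4^-1 *: ((ext_row D X z)^T *m X).
Proof.
move=> Dsym G; set a := ext_row D X z; set p := rsubmx z; set P := (p *m X^T) 0 0.
have pX : p *m X^T = P%:M by rewrite [LHS]mx11_scalar.
have Xp : X *m p^T = P%:M by rewrite dotmxC.
pose s := G *m p^T; pose r := X *m G.
have HE : base_conn_mx D X z = G - 2^-1 *: (P%:M + p^T *m X) by [].
(* The coefficient [1] is kept so that [conn_mxB] applies to this combination. *)
have XH : X *m base_conn_mx D X z = 1 *: r - P *: X.
  rewrite HE mulmxBr -scalemxAr mulmxDr mul_mx_scalar mulmxA Xp mul_scalar_mx.
  by rewrite -scalerDl scalerA scale1r; congr (_ - _ *: _); field.
have aE : a = P *: p - 2 *: s^T by rewrite /a ext_rowE // /s trmx_mul trmxK.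
pose q := (p *m r^T) 0 0.
have sX : (s^T *m X^T) 0 0 = q.
  by rewrite /q /s /r !trmx_mul trmxK mulmxA.
have aX : (a *m X^T) 0 0 = P ^+ 2 - 2 * q.
  have entry (c : R) (A B : 'M[R]_1) : (c *: A - 2 *: B) 0 0 = c * A 0 0 - 2 * B 0 0.
    by rewrite !mxE.
  by rewrite aE mulmxBl -!scalemxAl entry sX -/P; ring.
have HH : base_conn_mx D X z *m base_conn_mx D X z =
    G *m G - P *: G - 2^-1 *: (s *m X) - 2^-1 *: (p^T *m r) + (4^-1 * P ^+ 2)%:M
    + (3 / 4 * P) *: (p^T *m X).
  rewrite HE mulmxBl !mulmxBr -!scalemxAl -!scalemxAr !mulmxDl !mulmxDr.
  rewrite !mul_mx_scalar !mul_scalar_mx !mulmxA -(mulmxA p^T X p^T) Xp mul_mx_scalar.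
  rewrite -/s -(mulmxA p^T X G) -/r -scalemxAl.
  by move: (G *m G) (s *m X) (p^T *m r) (p^T *m X) => GG sx pr px;
     apply/matrixP => i k; rewrite !mxE; case: (i == k); rewrite ?mulr1n ?mulr0n; field.
rewrite HH XH /base_conn_mx conn_mxB -/p -/G -/r aX.
have pW : (p *m (1 *: r - P *: X)^T) 0 0 = q - P ^+ 2.
  have entry (A B : 'M[R]_1) : (1 *: A - P *: B) 0 0 = A 0 0 - P * B 0 0.
    by rewrite !mxE; ring.
  have -> : (1 *: r - P *: X)^T = 1 *: r^T - P *: X^T by apply/matrixP => i j; rewrite !mxE.
  by rewrite mulmxBr -!scalemxAr entry -/q -/P; ring.
rewrite pW aE; move: (G *m G) => GG.
apply/matrixP => i k; rewrite !mxE !big_ord1 !mxE.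
by case: (i == k); rewrite ?mulr1n ?mulr0n; field.
Qed.

(** [base_conn_curvature] converts the quadratic terms into those of [D], which complete [E], plus
    terms in [a]. The coefficient 3/4 is the 1 in front of [X^T *m ext_row D X z] less the 1/4 from
    that conversion; half of the [w] terms is cancelled by [dir]. *)
Lemma ext_jacobiE X w z : derivable_at D (lsubmx z) ->
  (\forall x \near lsubmx z, symmetric_at D x) ->
  let E := jacobi D (lsubmx z) X in
  let a := ext_row D X z in
  let e := ((a + 2 *: w) *m X^T) 0 0 in
  exists S, jacobi (ext_conn D) z (row_mx X w) = block_mx
    (E + (e / 4)%:M + (2^-1 *: w - 4^-1 *: a)^T *m X) S
    (- (X^T *m X)) (E^T + (e / 4)%:M + X^T *m (2^-1 *: w + (3 / 4) *: a)).
Proof.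
move=> dD near_sym E a e.
have Dsym : symmetric_at D (lsubmx z) by exact: nbhs_singleton near_sym.
have [S ->] := ext_jacobi_block X w dD near_sym; exists S.
have eE : e = (a *m X^T) 0 0 + 2 * (w *m X^T) 0 0.
  by rewrite /e mulmxDl -scalemxAl; move: (a *m _) (w *m _) => u v; rewrite !mxE.
have := base_conn_curvature X Dsym; rewrite -/a /=.
have EE : E = grad_row D X (lsubmx z) - grad_dir D X (lsubmx z)
    + conn_mx D (X *m conn_mx D X (lsubmx z)) (lsubmx z)
    - conn_mx D X (lsubmx z) *m conn_mx D X (lsubmx z).
  by rewrite /E jacobi_conn_mx.
rewrite EE eE {eE EE}.
move: (base_conn_mx D (X *m _) z) (base_conn_mx D X z *m base_conn_mx D X z) (grad_row _ _ _) (grad_dir _ _ _)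
  (conn_mx D (X *m _) _) (conn_mx D X _ *m _) ((a *m X^T) 0 0) ((w *m X^T) 0 0) => Hc HH gr gd C GG aX wX.
rewrite /a; move: (ext_row D X z) => b /eqP; rewrite subr_eq => /eqP ->.
congr block_mx; apply/matrixP => i k; rewrite !mxE !big_ord1 !mxE.
  by case: (i == k); rewrite ?mulr1n ?mulr0n; field.
by rewrite (eq_sym k i); case: (i == k); rewrite ?mulr1n ?mulr0n; field.
Qed.

(** Near [z] the Levi-Civita connection is [ext_conn], whose Jacobi operator has the shape required
    by [char_poly_osserman]; its two annihilation hypotheses are instances of [mul_jacobi_self]. *)
Lemma char_poly_jacobi_ext X w z k : (0 < n)%N -> derivable_at D (lsubmx z) ->
  (\forall x \near lsubmx z, symmetric_at D x /\ derivable_at D x) ->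
  jacobi D (lsubmx z) X ^+ k = 0 ->
  let e := ((ext_row D X z + 2 *: w) *m X^T) 0 0 in
  char_poly (jacobi (levi_civita (ext_metric D)) z (row_mx X w)) =
    'X * ('X - e%:P) * ('X - (e / 4)%:P) ^+ (2 * n - 2).
Proof.
move=> n0 dD near_x nil e.
have near_sym : \forall x \near lsubmx z, symmetric_at D x.
  by apply: filterS near_x => x [].
have Dsym : symmetric_at D (lsubmx z) by exact: nbhs_singleton near_sym.
have near_lc i j l : \near z, ext_conn D i j l z = levi_civita (ext_metric D) i j l z.
  have : \forall y \near z, symmetric_at D (lsubmx y) /\ derivable_at D (lsubmx y).
    exact: continuous_lsubmx near_x.
  by apply: filterS => y [sy dy]; rewrite levi_civita_ext.
have Esym := ext_conn_sym near_sym.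
rewrite -(jacobi_near _ Esym near_lc).
have [S JE] := ext_jacobiE X w dD near_sym; rewrite JE.
have jself : row_mx X w *m jacobi (ext_conn D) z (row_mx X w) = 0.
  by apply: mul_jacobi_self => // a b l i; exact: derivable_ext_conn.
apply: (char_poly_osserman n0 _ nil); rewrite -?JE //.
  by rewrite [LHS]mx11_scalar.
by apply: mul_jacobi_self => // a b l i; exact: dD.1.
Qed.

End Final.

(** * The modified extension of an affine manifold *)

(** This identifies the scalar [e] of the characteristic polynomial with g(Z,Z); the two identity
    blocks of the metric account for [2 *: w]. *)
Lemma ext_metric_norm (R : realType) (n : nat) (D : christoffel R n) (X w : 'rV[R]_n) z :
  \sum_i \sum_j ext_metric D z i j * row_mx X w 0 i * row_mx X w 0 j =
  ((ext_row D X z + 2 *: w) *m X^T) 0 0.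
Proof.
rewrite big_split_ord /=.
have sum1 (f : 'I_n -> R) k : \sum_l (1%:M : 'M[R]_n) k l * f l = f k.
  by rewrite -[RHS](sum_delta f); apply: eq_bigr => l _; rewrite mxE eq_sym mulrC.
under eq_bigr => i _.
  rewrite big_split_ord /=.
  under eq_bigr => j _ do rewrite block_mxEul mxE !row_mxEl.
  under [X in _ + X]eq_bigr => j _ do rewrite block_mxEur row_mxEl row_mxEr -mulrA.
  rewrite sum1.
  over.
under [X in _ + X]eq_bigr => i _.
  rewrite big_split_ord /=.
  under eq_bigr => j _ do rewrite block_mxEdl row_mxEl row_mxEr -mulrA.
  under [X in _ + X]eq_bigr => j _ do rewrite block_mxEdr mxE !mul0r.
  rewrite sum1 big1_eq addr0.
  over.
rewrite -big_split /= mxE; under [RHS]eq_bigr => j _ do rewrite [X^T _ _]mxE mxE mxE mulrDl.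
rewrite [RHS]big_split /= [LHS](eq_bigr (fun i => (\sum_j ext_quad D i j z * X 0 i * X 0 j) + 2 * w 0 i * X 0 i)); last first.
  by move=> i _; ring.
rewrite big_split /= exchange_big /=; congr (_ + _); apply: eq_bigr => j _; last by rewrite mxE.
rewrite mulr_suml; apply: eq_bigr => i _; rewrite [(\matrix_(_, _) _) _ _]mxE; ring.
Qed.

Lemma smooth_cst (R : realType) (n : nat) (V : normedModType R) (U : set 'rV[R]_n) (c : V) :
  smooth_on U (cst c).
Proof.
move=> s x _; have [c' ->] : exists c', foldr (@pd R n V) (cst c) s = cst c'.
  elim: s => [|i s [c' IH]]; first by exists c.
  by exists 0; rewrite /= IH; apply/funext => y; exact: pd_cst.
exact: differentiable_cst.
Qed.

Section AffineManifold.
Variables (R : realType) (n : nat) (M : affine_manifold R n).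

(** Torsion-freeness is applied to coordinate fields, whose bracket is zero. *)
Lemma am_conn_sym c x : chart_range c x -> symmetric_at (am_conn M c) x.
Proof.
move=> cx i j k.
have := am_torsion_free (smooth_cst (delta_mx 0 i)) (smooth_cst (delta_mx 0 j)) cx.
have -> : bracket (cst (delta_mx 0 i)) (cst (delta_mx 0 j)) x = 0 :> 'rV[R]_n.
  by apply/rowP => l; rewrite mxE [RHS]mxE big1 // => m _; rewrite /= !pd_cst !mulr0 subrr.
rewrite !cov_cst -!rowE => /eqP; rewrite subr_eq0 => /eqP/rowP/(_ k).
have dE (a b : 'I_n) : (conn_mx (am_conn M c) (delta_mx 0 b) x) a k = am_conn M c a b k x.
  rewrite mxE -[RHS](sum_delta (fun b => am_conn M c a b k x)).
  by apply: eq_bigr => l _; rewrite mxE eqxx mulrC.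
by rewrite mxE [RHS]mxE !dE.
Qed.

Lemma am_conn_derivable c x : chart_range c x -> derivable_at (am_conn M c) x.
Proof.
move=> cx; have smooth := (am_connection M).1 c.
split=> [i j k v|a i j k v]; apply: diff_derivable.
  exact: (smooth i j k [::] x cx).
exact: (smooth i j k [:: a] x cx).
Qed.

Lemma open_chart_range (c : chart M) : open (chart_range c).
Proof. by have := @overlap_open _ _ _ (am_smooth M) c c; rewrite /overlap setIid. Qed.

Lemma eigen_mult_jacobi_g (Q : mpoint (cotangent M)) (xi : tangent Q) (e : R) (z : R[i]) :
  affine_osserman_at M (cot_proj Q) -> unit_tangent (modified_extension M) e xi -> e != 0 ->
  eigen_mult (jacobi_g (modified_extension M) xi) z =
  ((z == 0)%R + (z == e%:C%C)%R + (2 * n - 2) * (z == (e / 4)%:C%C)%R)%N.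
Proof.
case: xi => c cQ Z oss; rewrite /unit_tangent /jacobi_g /= => unitZ e0.
(* In dimension zero the norm is an empty sum, contrary to [e != 0]. *)
have n0 : (0 < n)%N.
  case: (posnP n) => // n0; move: e0; rewrite -unitZ big1 ?eqxx // => i _.
  have n2 : (n + n = 0)%N by rewrite n0.
  by have := ltn_ord i; rewrite [X in (_ < X)%N]n2.
move: unitZ; set x := @chart_coord R n M c (projT1 Q); set z0 := row_mx x _ => unitZ.
have xE : lsubmx z0 = x by rewrite row_mxKl.
have cx : @chart_range R n M c x by exists (projT1 Q).
(* Nilpotency is used for the horizontal component of the vector, read in the same chart. *)
have [k nil] := oss (@Tangent R n M (cot_proj Q) c cQ (lsubmx Z)).
have mE : modified_extension M c = ext_metric (am_conn M c) by [].
rewrite mE; move: unitZ; rewrite mE -[Z]hsubmxK ext_metric_norm => unitZ.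
apply: eigen_mult_char_poly; rewrite -unitZ; apply: char_poly_jacobi_ext => //.
- by rewrite xE; exact: am_conn_derivable.
- rewrite xE; have : \forall y \near x, @chart_range R n M c y by exact: open_nbhs_nbhs (conj (@open_chart_range c) cx).
  by apply: filterS => y cy; split; [exact: am_conn_sym|exact: am_conn_derivable].
- by rewrite xE; exact: nil.
Qed.

(** Allowing two base points covers both the pointwise and the global Osserman property. *)
Lemma same_eigenvalues_jacobi_g (Q Q' : mpoint (cotangent M)) (xi : tangent Q) (eta : tangent Q')
    (e : R) : e = 1 \/ e = -1 ->
  affine_osserman_at M (cot_proj Q) -> affine_osserman_at M (cot_proj Q') ->
  unit_tangent (modified_extension M) e xi -> unit_tangent (modified_extension M) e eta ->
  same_eigenvalues (jacobi_g (modified_extension M) xi) (jacobi_g (modified_extension M) eta).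
Proof.
move=> e1 oss oss' xi1 eta1 z.
have e0 : e != 0 by case: e1 => ->; rewrite ?oppr_eq0 oner_eq0.
exact: etrans (eigen_mult_jacobi_g z oss xi1 e0) (esym (eigen_mult_jacobi_g z oss' eta1 e0)).
Qed.

End AffineManifold.

Theorem theorem1p2 (R : realType) (n : nat) (M : affine_manifold R n) :
  (forall P : mpoint M, affine_osserman_at M P ->
     forall Q : mpoint (cotangent M), cot_proj Q = P ->
       osserman_at (modified_extension M) Q /\
       (forall xi : tangent Q, unit_tangent (modified_extension M) 1 xi ->
          forall z : R[i],
            eigen_mult (jacobi_g (modified_extension M) xi) z =
            ((z == 0)%R + (z == 1)%R + (2 * n - 2) * (z == 4^-1)%R)%N) /\
       (forall xi : tangent Q, unit_tangent (modified_extension M) (-1) xi ->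
          forall z : R[i],
            eigen_mult (jacobi_g (modified_extension M) xi) z =
            ((z == 0)%R + (z == -1)%R + (2 * n - 2) * (z == - 4^-1)%R)%N)) /\
  (affine_osserman M -> osserman (modified_extension M)).
Proof.
have q : (4^-1 : R)%:C%C = 4^-1 by rewrite fmorphV /= rmorph_nat.
split=> [P oss Q QP|oss e e1 Q Q' xi eta]; last first.
  by apply: same_eigenvalues_jacobi_g => //; exact: oss.
rewrite -QP in oss; split; first by move=> e e1 xi eta; exact: same_eigenvalues_jacobi_g.
split=> xi xi1 z.
  by apply: etrans (eigen_mult_jacobi_g z oss xi1 (oner_neq0 R)) _; rewrite mul1r q.
have m1 : -1 != 0 :> R by rewrite oppr_eq0 oner_eq0.
by apply: etrans (eigen_mult_jacobi_g z oss xi1 m1) _; rewrite mulN1r !rmorphN /= q.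
Qed.
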